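(* Let $G$ be an infinite graph and let $A,B\subseteq V(G)$. (i) If $G$ is a digraph, then there is a domination linkage from $A$ to $B$ if and only if every finite subset of $A$ can be linked to $B$ by vertex-disjoint directed paths. (ii) If $G$ is undirected, then $A$ can be linked by disjoint paths and rays to the closure of $B$ if and only if every finite subset of $A$ can be linked to $B$ by vertex-disjoint paths.
   Context: All paths are finite. Directed setting (part (i)): a directed ray $R$ dominates $B$ if $G$ contains infinitely many vertex-disjoint directed paths from vertices of $R$ to $B$; a vertex $v$ dominates $B$ if there are infinitely many directed paths from $v$ to $B$ that are vertex-disjoint except in $v$; a directed path dominates $B$ if its last vertex dominates $B$. A domination linkage from $A$ to $B$ is a family $(Q_a\mid a\in A)$ of vertex-disjoint directed paths or directed rays such that $Q_a$ starts in $a$ and either ends in a vertex of $B$ or dominates $B$. A finite set $S$ can be linked to $B$ by vertex-disjoint directed paths if there are vertex-disjoint directed paths $(P_s\mid s\in S)$ with $P_s$ starting at $s$ and ending in $B$. Undirected setting (part (ii)): consider $G$ (as a 1-complex) together with its ends, with the topology whose basic open sets are the components $C$ of $G\setminus X$, where $X$ is a finite set of inner points of edges, together with the ends that have rays in $C$. The closure of $B$ in this space consists of $B$, the vertices $v$ dominating $B$ (infinitely many $v$–$B$ paths disjoint except in $v$), and the ends $\omega$ whose rays dominate $B$ (a ray $R$ dominates $B$ if there are infinitely many vertex-disjoint paths from $R$ to $B$). ''$A$ can be linked by disjoint paths and rays to the closure of $B$'' means there is a family $(Q_a\mid a\in A)$ of vertex-disjoint paths or rays, $Q_a$ starting at $a$,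 such that each path $Q_a$ ends in a vertex of the closure of $B$ and each ray $Q_a$ belongs to an end in the closure of $B$. *)

(* Defs.v *)
From mathcomp Require Import all_boot all_classical.

Set Implicit Arguments.
Unset Strict Implicit.
Unset Printing Implicit Defensive.

Local Open Scope classical_set_scope.

(* A digraph is an edge relation [E : rel V] on its vertex type; an undirected
   graph is a symmetric irreflexive one, so that its paths and rays are the
   directed paths and directed rays of [E].  Paths and rays are determined by
   their vertex sequences; parallel edges would not affect anything below. *)

Section Graphs.
Variables (V : choiceType) (E : rel V).
Implicit Types (x y v : V) (p : seq V) (r : nat -> V) (A B S : set V).

(* [p] lists the vertices of the path, both ends included; hence [p] is
   nonempty, and [p = [:: x]] is the trivial path. *)
Definition dipath x y p : bool :=
  if p is z :: q then [&& z == x, last z q == y, path E z q & uniq p]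
  else false.

Definition dipath_to x B p : Prop := exists2 y, B y & dipath x y p.

Definition diray r : Prop := injective r /\ forall n, E (r n) (r n.+1).

(* "Infinitely many paths" is an infinite set of paths rather than a sequence:
   if [v] lies in [B], the trivial path at [v] is disjoint from itself outside
   [v] and must be counted only once. *)
Definition vertex_dominates B v : Prop :=
  exists P : set (seq V), [/\ infinite_set P,
    forall p, P p -> dipath_to v B p &
    trivIset P (fun p => [set` p] `\ v)].

Definition ray_dominates B r : Prop :=
  exists P : set (seq V), [/\ infinite_set P,
    forall p, P p -> exists2 x, range r x & dipath_to x B p &
    trivIset P (fun p => [set` p])].

Inductive path_or_ray := FinPath of seq V | Ray of (nat -> V).

Definition vertices (q : path_or_ray) : set V :=
  match q with FinPath p => [set` p] | Ray r => range r end.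

(* Families indexed by a subset of [V] are functions on [V] whose values
   outside that subset are irrelevant. *)
Definition domination_linkage A B (Q : V -> path_or_ray) : Prop :=
  trivIset A (vertices \o Q) /\
  forall a, A a -> match Q a with
    | FinPath p => exists2 y, dipath a y p & B y \/ vertex_dominates B y
    | Ray r => [/\ diray r, r 0 = a & ray_dominates B r]
    end.

Definition linkable S B : Prop :=
  exists P : V -> seq V,
    trivIset S (fun s => [set` P s]) /\ forall s, S s -> dipath_to s B (P s).

(* The remaining definitions are meant for undirected graphs. *)

(* For every finite [S], the two rays have tails in a common component of the
   graph minus [S]. *)
Definition ray_equiv r r' : Prop :=
  forall S, finite_set S -> exists m n,
    [/\ forall i, m <= i -> ~ S (r i),
        forall j, n <= j -> ~ S (r' j) &
        exists2 p, dipath (r m) (r' n) p & [set` p] `&` S = set0].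

Definition is_end (w : set (nat -> V)) : Prop :=
  exists2 r, diray r & w = [set r' | diray r' /\ ray_equiv r r'].

(* The closure of [B] in the graph together with its ends, split into its
   vertices and its ends; it contains no inner points of edges.  It is the set
   of points that no finite set of vertices and inner points of edges, avoiding
   the point itself, separates from [B]; separating by inner points of edges
   only would give a larger set, for which two vertices infinitely
   edge-connected to [B = [set u]] would both lie in the closure. *)
Definition closure_vertices B : set V := B `|` [set v | vertex_dominates B v].

Definition closure_ends B : set (set (nat -> V)) :=
  [set w | is_end w /\ forall r, w r -> ray_dominates B r].

Definition closure_linkage A B (Q : V -> path_or_ray) : Prop :=
  trivIset A (vertices \o Q) /\
  forall a, A a -> match Q a with
    | FinPath p => dipath_to a (closure_vertices B) p
    | Ray r => [/\ diray r, r 0 = a & exists2 w, closure_ends B w & w r]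
    end.

End Graphs.

(* Main.v *)
(** Call a set D of vertices tight if it contains as many vertices of A as its
    boundary has vertices, both numbers being finite; the boundary consists of the
    vertices of D that lie in B or send an edge out of D.  If every finite subset of A
    can be linked to B, then a set has at least as many boundary vertices as
    vertices of A, so by submodularity tight sets are closed under unions and
    intersections, and linkages of tight sets can be extended to larger tight
    sets.  By Zorn's lemma this yields a linkage, given by a relation M between
    vertices, of all tight sets simultaneously; its trajectories are paths or rays,
    and the rays leave every tight set.

    To have enough tight sets, add to every vertex v infinitely many dummy copies
    that are only sources, replace B by its closure, and extend A to a maximal set
    of sources all of whose finite subsets are still linkable.  By Menger's theorem,
    maximality places every vertex in a tight set, and in the interior of one if it
    is not in the closure of B.  A ray whose tail were separated from B by a
    finite set X would then stay in the tight set obtained by adding the vertices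
    separated by X to a tight set around X. *)
Require Import Defs.
From mathcomp Require Import all_boot finmap all_classical zify.

Set Implicit Arguments.
Unset Strict Implicit.
Unset Printing Implicit Defensive.

Local Open Scope classical_set_scope.

(** * Menger's theorem for a finite set of sources *)

Section Menger.
Variables (V : choiceType) (E : rel V).
Implicit Types (x y z : V) (p q r X : seq V) (B : pred V).

Lemma split_last (F : pred V) x r :
  has F (x :: r) -> exists r1 r2, [/\ r = r1 ++ r2, F (last x r1) & ~~ has F r2].
Proof.
elim/last_ind: r => [|r z IH]; first by rewrite /= orbF => Fx; exists [::], [::].
case: (boolP (F z)) => [Fz _|nFz].
  by exists (rcons r z), [::]; rewrite cats0 last_rcons.
rewrite -rcons_cons has_rcons (negbTE nFz) /= => /IH[r1 [r2 [-> F1 F2]]].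
by exists r1, (rcons r2 z); rewrite rcons_cat has_rcons (negbTE nFz).
Qed.

Lemma split_first (F : pred V) x r :
  has F (x :: r) ->
  exists r1 r2, [/\ r = r1 ++ r2, F (last x r1) & ~~ has F (belast x r1)].
Proof.
elim: r x => [|z r IH] x /=; first by rewrite orbF => Fx; exists [::], [::].
case: (boolP (F x)) => [Fx _|nFx /= /IH[r1 [r2 [-> F1 F2]]]].
  by exists [::], (z :: r).
by exists (z :: r1), r2; rewrite /= (negbTE nFx).
Qed.

Lemma shorten_first B x r : path E x r -> B (last x r) ->
  exists r', [/\ path E x r', B (last x r'), ~~ has B (belast x r'),
    uniq (x :: r') & {subset x :: r' <= x :: r}].
Proof.
case/shortenP => p Ep Up sub Bp.
have /split_first[r1 [r2 [def_p B1 nB1]]] : has B (x :: p).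
  by apply/hasP; exists (last x p) => //; rewrite mem_last.
exists r1; move: Ep Up sub; rewrite def_p cat_path -cat_cons cat_uniq.
move=> /andP[-> _] /andP[-> _] sub; split=> // z; rewrite !inE.
by case/predU1P => [->|zr1]; rewrite ?eqxx // sub ?orbT // mem_cat zr1.
Qed.

(* Paths are written [(x, q)], with vertex sequence [x :: q]. *)
Definition verts (P : V * seq V) := P.1 :: P.2.
Definition tip (P : V * seq V) := last P.1 P.2.
(** Meeting [B] only at the tip lets a path be prolonged when the target shrinks: the only vertex of
    the old target on it is its tip. *)
Definition good_path (S : seq V) B (P : V * seq V) :=
  [&& P.1 \in S, path E P.1 P.2, B (tip P) & ~~ has B (belast P.1 P.2)].
Definition path_system S B (ps : seq (V * seq V)) :=
  uniq (flatten (map verts ps)) && all (good_path S B) ps.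

Lemma tip_verts P : tip P \in verts P.
Proof. exact: mem_last. Qed.

Lemma flatten_verts P ps :
  flatten (map verts (P :: ps)) = verts P ++ flatten (map verts ps).
Proof. by []. Qed.

Lemma uniq_map_verts (g : V * seq V -> V) (ps : seq (V * seq V)) :
  (forall P, g P \in verts P) -> uniq (flatten (map verts ps)) -> uniq (map g ps).
Proof.
move=> gP; elim: ps => // P ps IH; rewrite flatten_verts cat_uniq => /and3P[_ /hasPn d u].
rewrite /= (IH u) andbT; apply/mapP => -[Q Qps eq_g].
have /d : g P \in flatten (map verts ps).
  by apply/flatten_mapP; exists Q; rewrite // eq_g gP.
by rewrite /= gP.
Qed.

Lemma uniq_verts_inj (ps : seq (V * seq V)) P Q z : uniq (flatten (map verts ps)) ->
  P \in ps -> Q \in ps -> z \in verts P -> z \in verts Q -> P = Q.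
Proof.
elim: ps => // R ps IH; rewrite flatten_verts cat_uniq => /and3P[_ /hasPn d u].
have dR S : S \in ps -> z \in verts S -> z \notin verts R.
  by move=> Sps zS; apply: d; apply/flatten_mapP; exists S.
rewrite !inE => /predU1P[->|Pps] /predU1P[->|Qps] // zP zQ; last exact: IH.
  by have /negP := dR _ Qps zQ.
by have /negP := dR _ Pps zP.
Qed.

Lemma path_system_perm S B ps qs :
  perm_eq ps qs -> path_system S B ps = path_system S B qs.
Proof.
move=> pq; rewrite /path_system (perm_all _ pq); congr (_ && _).
exact/perm_uniq/perm_flatten/perm_map.
Qed.

Lemma good_path_meets S B P z : good_path S B P -> z \in verts P -> B z -> z = tip P.
Proof.
case: P => x q /and4P[_ _ _ /hasPn nB]; rewrite /verts /= lastI mem_rcons inE.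
by case/predU1P => // /nB /negbTE; rewrite /mem /= => ->.
Qed.

Lemma good_path_extend S B B' P c : (forall z, B z -> B' z) ->
  good_path S B' P -> path E (tip P) c -> B (last (tip P) c) ->
  ~~ has B (belast (tip P) c) -> good_path S B (P.1, P.2 ++ c).
Proof.
case: P => x q sBB' /and4P[/= xS Eq B'q nB'] Ec Bc nBc.
rewrite /good_path /tip /= xS cat_path Eq Ec last_cat Bc belast_cat has_cat.
rewrite (negbTE nBc) orbF /=; apply: contra nB' => /hasP[z zq /sBB' B'z].
by apply/hasP; exists z.
Qed.

(** The tails [c] and [d] consist of vertices of [B'] that are not tips, while the paths of the
    system meet [B'] in their tips only; so the tails are disjoint from the whole system. *)
Lemma path_system_splice S B B' P Q qs c d : (forall z, B z -> B' z) ->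
  path_system S B' (P :: Q :: qs) -> all B (map tip qs) ->
  path E (tip P) c -> B (last (tip P) c) -> ~~ has B (belast (tip P) c) ->
  path E (tip Q) d -> B (last (tip Q) d) -> ~~ has B (belast (tip Q) d) ->
  uniq (c ++ d) -> all B' (c ++ d) ->
  ~~ has (mem (c ++ d)) (map tip (P :: Q :: qs)) ->
  path_system S B ((P.1, P.2 ++ c) :: (Q.1, Q.2 ++ d) :: qs).
Proof.
move=> sBB' /andP[Uqs] /and3P[gP gQ /allP gqs] Bqs Ec Bc nBc Ed Bd nBd Ucd.
move=> /allP B'cd /hasPn tips; apply/andP; split; last first.
  rewrite /= (good_path_extend sBB' gP) // (good_path_extend sBB' gQ) //=.
  apply/allP => R Rqs; have /and4P[R1 R2 R3 R4] := gqs R Rqs.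
  rewrite /good_path R1 R2 (allP Bqs) ?map_f //=.
  by apply: contra R4 => /hasP[z zR /sBB' B'z]; apply/hasP; exists z.
have -> : uniq (flatten (map verts ((P.1, P.2 ++ c) :: (Q.1, Q.2 ++ d) :: qs)))
    = uniq (flatten (map verts (P :: Q :: qs)) ++ (c ++ d)).
  have vE R e : verts (R.1, R.2 ++ e) = verts R ++ e by [].
  apply/perm_uniq/permP => a; rewrite !flatten_verts !vE !count_cat; clear; lia.
rewrite cat_uniq Uqs Ucd andbT andTb; apply/hasPn => z zcd.
apply/negP => /flatten_mapP[R Rqs zR].
have gR : good_path S B' R.
  by move: Rqs; rewrite !inE => /or3P[/eqP->|/eqP->|/gqs].
have := good_path_meets gR zR (B'cd z zcd) => def_z.
by have /tips := map_f tip Rqs; rewrite -def_z /= zcd.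
Qed.

(* Böhme, Göring and Harant's proof of Menger's theorem: the induction enlarges
   [B] along a path of the system and a path avoiding the tips of the system. *)
Lemma path_system_augment S n B ps : size (flatten (map verts ps)) < n ->
  path_system S B ps ->
  (forall X, size X <= size ps -> exists x r,
     [/\ x \in S, path E x r, B (last x r) & ~~ has (mem X) (x :: r)]) ->
  exists qs, [/\ path_system S B qs, size qs = (size ps).+1 &
     {subset map tip ps <= map tip qs}].
Proof.
elim: n B ps => // n IH B ps le_n sys_ps nosep.
have /andP[Ups /allP gps] := sys_ps.
(* There are only as many tips as paths, so some path from [S] to [B] avoids them. *)
have [|x0 [r0 [x0S Er0 Br0 r0_tips]]] := nosep (map tip ps).
  by rewrite size_map.
have [r [Er Br nBr Ur sub_r]] := shorten_first Er0 Br0.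
have {r0_tips} r_tips : ~~ has (mem (map tip ps)) (x0 :: r).
  by apply: contra r0_tips => /hasP[z /sub_r zr zt]; apply/hasP; exists z.
have gr : good_path S B (x0, r) by apply/and4P.
case: (boolP (has (mem (flatten (map verts ps))) (x0 :: r))); last first.
  move=> r_ps; exists ((x0, r) :: ps); split=> //; last first.
    by move=> z zt; rewrite inE zt orbT.
  rewrite /path_system flatten_verts cat_uniq [verts _]/= Ur Ups andTb andbT.
  by rewrite has_sym r_ps [all _ _]/= gr; exact/allP.
(* [x] is the last vertex of the new path on the system, and [P] is the path of the system through
   [x]. From [x] the two continue disjointly to [B], along [r2] and along what becomes [p2]. *)
case/split_last=> r1 [r2 [def_r /flatten_mapP[P Pps xP] r2_ps]].
set x := last x0 r1 in xP.
have [ps' perm_ps] : exists ps', perm_eq ps (P :: ps').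
  by exists (rem P ps); exact: perm_to_rem.
rewrite (path_system_perm _ _ perm_ps) in sys_ps.
have tips_ps : map tip ps =i map tip (P :: ps').
  exact/perm_mem/perm_map.
have mem_ps : flatten (map verts ps) =i flatten (map verts (P :: ps')).
  exact/perm_mem/perm_flatten/perm_map.
have sz_ps : size ps = (size ps').+1 by rewrite (perm_size perm_ps).
have xR : x \in x0 :: r by rewrite def_r -cat_cons mem_cat mem_last.
have x_tips : x \notin map tip ps by exact: (hasPn r_tips).
case: P => z p in Pps xP perm_ps sys_ps tips_ps mem_ps *.
have {}xP : x \in z :: p := xP.
move: xP Pps perm_ps sys_ps tips_ps mem_ps.
case/splitPl=> p1 p2 def_x Pps perm_ps sys_ps tips_ps mem_ps.
clear Ups gps.
have x_ps' : x \notin map tip ps'.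
  by apply: contra x_tips; rewrite tips_ps inE => ->; rewrite orbT.
have tipP : tip (z, p1 ++ p2) = last x p2 by rewrite /tip /= last_cat def_x.
have /andP[Ups /andP[gP gps']] := sys_ps.
have /and4P[/= zS Ep Bp nBp] := gP; rewrite tipP in Bp.
have x_p2 : x != last x p2.
  by apply: contra x_tips; rewrite tips_ps inE tipP => ->.
move: Ups; rewrite flatten_verts /verts -cat_cons -catA cat_uniq => /and3P[Up1].
rewrite cat_uniq has_cat negb_or => /andP[p1_p2 p1_ps'] /and3P[Up2 p2_ps' Ups'].
have {}xp1 : x \in z :: p1 by rewrite -def_x mem_last.
move: Ep nBp; rewrite cat_path belast_cat has_cat negb_or def_x.
move=> /andP[Ep1 Ep2] /andP[nBp1 nBp2].
have xNp2 : x \notin p2 by apply: contraL xp1 => xp2; exact: (hasPn p1_p2).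
move: Er Br nBr Ur; rewrite def_r cat_path last_cat belast_cat has_cat -/x.
rewrite negb_or -cat_cons cat_uniq => /andP[Er1 Er2] Br2 /andP[nBr1 nBr2].
move=> /and3P[Ur1 r1_r2 Ur2].
have xNr2 : x \notin r2.
  by apply: contraL (mem_last x0 r1) => xr2; exact: (hasPn r1_r2).
have r2P w : w \in r2 -> [/\ w \notin z :: p1, w \notin p2 &
    w \notin flatten (map verts ps')].
  move=> wr2; have : w \notin flatten (map verts ps) := hasPn r2_ps w wr2.
  by rewrite mem_ps flatten_verts /verts -cat_cons !mem_cat !negb_or -andbA => /and3P.
(* With [x] and both continuations in the target, [P] is cut off at [x]. Since [x] is not the tip of
   [P], the system loses vertices; and whatever separates [S] from [B'] also separates it from
   [B]. *)
pose B' : pred V := fun w => [|| B w, w == x, w \in p2 | w \in r2].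
have B'P w : B' w = [|| B w, w == x, w \in p2 | w \in r2] by [].
have sBB' w : B w -> B' w by rewrite B'P => ->.
have sys1 : path_system S B' ((z, p1) :: ps').
  apply/andP; split.
    by rewrite flatten_verts cat_uniq [uniq (verts _)]Up1 p1_ps' Ups'.
  apply/andP; split.
    apply/and4P; split=> //; first by rewrite B'P [tip _]def_x eqxx orbT.
    apply/hasPn => w wp1; have wP : w \in z :: p1 by rewrite mem_belast.
    rewrite B'P !negb_or (hasPn nBp1 w wp1).
    have -> : w != x.
      move: Up1; rewrite lastI rcons_uniq def_x => /andP[xp1' _].
      by apply: contraNneq xp1' => <-.
    have -> : w \notin p2 by apply: contraL wP => /(hasPn p1_p2).
    by apply: contraL wP => /r2P[].
  apply/allP => R Rps'; have /and4P[R1 R2 R3 R4] := allP gps' R Rps'.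
  apply/and4P; split=> //; first exact: sBB'.
  apply/hasPn => w wR; rewrite B'P !negb_or (hasPn R4 w wR).
  have wF : w \in flatten (map verts ps').
    by apply/flatten_mapP; exists R; rewrite // mem_belast.
  have -> : w != x.
    apply: contraNneq p1_ps' => eq_wx.
    by apply/hasP; exists w; rewrite // eq_wx; exact: xp1.
  have -> : w \notin p2 := hasPn p2_ps' w wF.
  by apply: contraL wF => /r2P[].
have [|X leX|qs [sys_qs sz_qs tips_qs]] := IH B' _ _ sys1.
- move: le_n; rewrite (perm_size (perm_flatten (perm_map verts perm_ps))).
  have : 0 < size p2 by case: (p2) x_p2; rewrite ?eqxx.
  rewrite !flatten_verts !size_cat /= size_cat; clear; lia.
- have [|u [q [uS Eq Bq nXq]]] := nosep X; first by rewrite sz_ps.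
  by exists u, q; split=> //; exact: sBB'.
(* The induction keeps the tip [x] and those of [ps'] and adds one tip [y]. It remains to continue
   from [x] and [y] to [B] inside [p2] and [r2]. *)
have /mapP[Qx Qx_qs tipQx] : x \in map tip qs.
  by apply: tips_qs; rewrite inE [tip _]def_x eqxx.
have perm_qs := perm_to_rem Qx_qs; set q1 := rem Qx qs in perm_qs.
have sz_q1 : size q1 = (size ps').+1.
  by have := perm_size perm_qs; rewrite sz_qs => -[].
have [Qy Qy_q1 Qy_ps'] : exists2 Qy, Qy \in q1 & tip Qy \notin map tip ps'.
  apply/hasP; apply/negP => /negP/hasPn q1_ps'.
  have : size (map tip q1) <= size (map tip ps').
    apply: uniq_leq_size => [|w /mapP[Q Qq1 ->]]; last by have /negPn := q1_ps' Q Qq1.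
    have /andP[/(uniq_map_verts tip_verts) + _] := sys_qs.
    by rewrite (perm_uniq (perm_map tip perm_qs)) => /andP[].
  by rewrite !size_map sz_q1 ltnn.
have perm_q1 := perm_to_rem Qy_q1; set qs' := rem Qy q1 in perm_q1.
have {perm_q1}perm_qs : perm_eq qs [:: Qx, Qy & qs'].
  by apply: perm_trans perm_qs _; rewrite perm_cons.
have sz_qs' : size qs' = size ps'.
  by have := perm_size perm_qs; rewrite sz_qs => -[].
rewrite (path_system_perm _ _ perm_qs) in sys_qs.
have /andP[/(uniq_map_verts tip_verts) Utips /allP gqs] := sys_qs.
set y := tip Qy in Qy_ps'.
have [x_y [xNqs' yNqs']] : x != y /\ x \notin map tip qs' /\ y \notin map tip qs'.
  by move: Utips; rewrite /= -tipQx inE negb_or => /and3P[/andP[-> ->] -> _].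
have [_ tips_qs'] : (size (map tip ps') = size (map tip qs')) *
    (map tip ps' =i map tip qs').
  apply: uniq_min_size; rewrite ?size_map ?sz_qs' ?(uniq_map_verts tip_verts) // => w wt.
  have : w \in map tip (Qx :: Qy :: qs').
    by rewrite -(perm_mem (perm_map tip perm_qs)) tips_qs // inE wt orbT.
  rewrite !inE -tipQx => /or3P[/eqP w_x|/eqP w_y|//].
    by rewrite -w_x wt in x_ps'.
  by rewrite /y -w_y wt in Qy_ps'.
have tip_ps'N w : w \in map tip qs' -> w \in flatten (map verts ps').
  rewrite -tips_qs' => /mapP[R Rps' ->].
  by apply/flatten_mapP; exists R; rewrite // tip_verts.
(* One continuation has to end at the tip of [P], because the old tips are to be kept. *)
have finish c d : path E x c -> B (last x c) -> ~~ has B (belast x c) ->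
    path E y d -> B (last y d) -> ~~ has B (belast y d) ->
    uniq (c ++ d) -> {subset c ++ d <= p2 ++ r2} -> x \notin c ++ d ->
    y \notin c ++ d -> last x p2 \in [:: last x c; last y d] ->
    exists qs0, [/\ path_system S B qs0, size qs0 = (size ps).+1 &
     {subset map tip ps <= map tip qs0}].
  move=> Ec Bc nBc Ed Bd nBd Ucd cd_sub xNcd yNcd tip_cd.
  exists [:: (Qx.1, Qx.2 ++ c), (Qy.1, Qy.2 ++ d) & qs']; split; first last.
  - move=> w; rewrite tips_ps inE tipP /= !inE /tip /= !last_cat -/(tip Qx) -tipQx.
    rewrite -/(tip Qy) -/y tips_qs' => /predU1P[->|->]; rewrite ?orbT //.
    by move: tip_cd; rewrite !inE orbA => ->.
  - by rewrite /= sz_qs' sz_ps.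
  apply: (path_system_splice sBB' sys_qs); rewrite -?tipQx //.
  - apply/allP => w; rewrite -tips_qs' => /mapP[R Rps' ->].
    by have /and4P[] := allP gps' R Rps'.
  - apply/allP => w /cd_sub; rewrite mem_cat => /orP[]wp; rewrite B'P wp ?orbT //.
  apply/hasPn => w; rewrite !inE -tipQx => /or3P[/eqP->|/eqP->|wt] //.
  apply/negP => /cd_sub; rewrite mem_cat => /orP[wp2|/r2P[_ _ /negP]]; last first.
    by apply; exact: tip_ps'N.
  by have /negP := hasPn p2_ps' w (tip_ps'N w wt).
have suffix s : path E x s -> B (last x s) -> ~~ has B (belast x s) -> uniq s ->
    y \in s -> exists b, [/\ path E y b, B (last y b), ~~ has B (belast y b),
      {subset b <= s} /\ uniq b & y \notin b /\ last y b = last x s].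
  move=> Es Bs nBs Us ys; case/path.splitP: ys Es Bs nBs Us => s1 s2.
  rewrite cat_path last_rcons last_cat last_rcons belast_cat has_cat last_rcons.
  rewrite negb_or cat_uniq => /andP[_ Es2] Bs2 /andP[_ nBs2] /and3P[_ d U].
  exists s2; split=> //; split=> //; first by move=> w ws; rewrite mem_cat ws orbT.
  by apply/negP => ys2; have /negP := hasPn d y ys2; rewrite /= mem_rcons mem_head.
have By : B' y by have /and4P[] : good_path S B' Qy by apply: gqs; rewrite !inE eqxx orbT.
have disj w : w \in r2 -> w \in p2 -> False by move=> /r2P[_ /negP].
(* If [y] lies on [p2], it takes the rest of [p2] and [x] takes [r2]; otherwise [x] takes [p2], and
   [y] follows the rest of [r2] or is in [B] already. *)
case: (boolP (y \in p2)) => yp2.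
  have [b [Eb Bb nBb [sub_b Ub] [yNb lb]]] := suffix p2 Ep2 Bp nBp2 Up2 yp2.
  apply: (finish r2 b) => //.
  - rewrite cat_uniq Ur2 Ub andbT; apply/hasPn => w /sub_b wp2.
    by apply/negP => /disj/(_ wp2).
  - by move=> w; rewrite !mem_cat => /orP[->|/sub_b ->]; rewrite ?orbT.
  - by rewrite mem_cat negb_or xNr2 (contra (sub_b x)).
  - by rewrite mem_cat negb_or yNb andbT; apply/negP => /disj/(_ yp2).
  - by rewrite lb !inE eqxx orbT.
have [b [Eb Bb nBb [sub_b Ub] yNb]] : exists b, [/\ path E y b, B (last y b),
    ~~ has B (belast y b), {subset b <= r2} /\ uniq b & y \notin b].
  case: (boolP (y \in r2)) => yr2.
    by have [b [? ? ? ? [? _]]] := suffix r2 Er2 Br2 nBr2 Ur2 yr2; exists b.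
  exists [::]; split=> //.
  by move: By; rewrite B'P eq_sym (negbTE x_y) (negbTE yp2) (negbTE yr2) !orbF.
apply: (finish p2 b) => //.
- rewrite cat_uniq Up2 Ub andbT; apply/hasPn => w /sub_b wr2.
  by apply/negP => /(disj w wr2).
- by move=> w; rewrite !mem_cat => /orP[->|/sub_b ->]; rewrite ?orbT.
- by rewrite mem_cat negb_or xNp2 (contra (sub_b x)).
- by rewrite mem_cat negb_or yNb yp2.
- by rewrite !inE eqxx.
Qed.

(** Without a small separator the empty system can be augmented up to [size S] paths. Their first
    vertices are distinct elements of [S], hence all of [S]. *)
Lemma menger (S : seq V) (B : set V) : uniq S ->
  linkable E [set` S] B \/ exists X : seq V, size X < size S /\
    forall x r, x \in S -> path E x r -> B (last x r) -> has (mem X) (x :: r).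
Proof.
move=> US; pose Bb : pred V := fun x => `[< B x >].
case: (pselect (exists X : seq V, size X < size S /\
    forall x r, x \in S -> path E x r -> B (last x r) -> has (mem X) (x :: r))) => nosep; first by right.
left.
have sys k : k <= size S -> exists ps, path_system S Bb ps /\ size ps = k.
  elim: k => [|k IH] lt_k; first by exists [::].
  have [ps [sys_ps sz_ps]] := IH (ltnW lt_k).
  have [X leX|qs [sys_qs sz_qs _]] := path_system_augment (ltnSn _) sys_ps.
    apply: contrapT => noR; apply: nosep; exists X; split.
      by rewrite (leq_ltn_trans leX) // sz_ps.
    move=> x r xS Er Br; apply: contrapT => /negP nX; apply: noR.
    by exists x, r; split=> //; apply/asboolP.
  by exists qs; rewrite sz_qs sz_ps.
have [ps [/andP[Ups /allP gps] sz_ps]] := sys _ (leqnn _).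
have sub_S : {subset map fst ps <= S} by move=> _ /mapP[P /gps/and4P[? _ _ _] ->].
have [_ eqS] : (size (map fst ps) = size S) * (map fst ps =i S).
  apply: uniq_min_size sub_S _; last by rewrite size_map sz_ps.
  by apply: (uniq_map_verts _ Ups) => P; exact: mem_head.
have pathP s : exists P, s \in S -> P \in ps /\ P.1 = s.
  case: (boolP (s \in S)); last by exists (s, [::]).
  by rewrite -eqS => /mapP[P Pps ->]; exists P.
have [f fP] := choice pathP.
exists (fun s => verts (f s)); split.
  move=> s t /= /fP[fs eqs] /fP[ft eqt] [w [/= ws wt]].
  by rewrite -eqs -eqt (uniq_verts_inj Ups fs ft ws wt).
move=> s /= /fP[fs def_s]; have /and4P[_ Ep /asboolP Bp _] := gps _ fs.
exists (tip (f s)) => //.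
have : uniq (flatten (map verts (f s :: rem (f s) ps))).
  by rewrite -(perm_uniq (perm_flatten (perm_map verts (perm_to_rem fs)))).
rewrite flatten_verts cat_uniq => /andP[Us _].
by move: Ep Us; rewrite /dipath /tip /verts def_s !eqxx => -> ->.
Qed.

End Menger.

(** * Segments and tails of vertex sequences *)

Lemma dipath_mkseq (V : choiceType) (E : rel V) (f : nat -> V) n :
  (forall i, i < n -> E (f i) (f i.+1)) ->
  (forall i j, i <= n -> j <= n -> f i = f j -> i = j) ->
  dipath E (f 0) (f n) (mkseq f n.+1).
Proof.
move=> Ef f_inj; have : uniq (mkseq f n.+1).
  by apply/mkseq_uniqP => i j; rewrite !inE => lti ltj; apply: f_inj.
rewrite /dipath {1 2}/mkseq /= => ->; rewrite eqxx andbT /=; apply/andP; split.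
  by rewrite (last_map f (iota 1 n) 0); case: (n) => // m; rewrite -nth_last size_iota nth_iota.
by apply/(pathP (f 0)) => -[|i]; rewrite size_map size_iota => lti /=;
  rewrite !(nth_map 0) ?size_iota ?nth_iota //; try apply: Ef; lia.
Qed.

Lemma ray_avoids T (r : nat -> T) (S : set T) : injective r -> finite_set S ->
  exists N, forall n, N <= n -> ~ S (r n).
Proof.
elim/Pchoice: T => T in r S *; move=> r_inj /finite_seqP[s ->].
elim: s => [|x s [N NP]]; first by exists 0.
case: (pselect (exists n, r n = x)) => [[n rn]|nx].
  exists (maxn N n.+1) => k lek /=; rewrite inE => /predU1P[rk|]; last by apply: NP; lia.
  by have := r_inj k n; rewrite rk rn => /(_ erefl); lia.
exists N => k lek /=; rewrite inE => /predU1P[rk|]; last exact: NP.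
by apply: nx; exists k.
Qed.

(** * Boundaries, tight sets and submodularity *)

Section TightSets.
Variables (W : choiceType) (E : rel W) (A B : set W).
Implicit Types (x y : W) (D P Q S : set W).

Definition boundary D : set W :=
  [set x | D x /\ (B x \/ exists2 y, E x y & ~ D y)].
Definition interior D : set W := D `\` boundary D.
(* Equal to [0] when [S] is infinite. *)
Definition card S := #|` fset_set S|.
Definition tight D :=
  [/\ finite_set (A `&` D), finite_set (boundary D) &
      card (A `&` D) = card (boundary D)].

Lemma interiorP D x : interior D x <-> [/\ D x, ~ B x & forall y, E x y -> D y].
Proof.
split=> [[Dx nbd]|[Dx nBx Ex]]; last first.
  by split=> // -[_ []// [y /Ex]].
split=> // [Bx|y Exy]; first by apply: nbd; split=> //; left.
by apply: contrapT => nDy; apply: nbd; split=> //; right; exists y.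
Qed.

Lemma sub_boundary P Q x : P `<=` Q -> P x -> boundary Q x -> boundary P x.
Proof. by move=> PQ Px [_ [Bx|[y Exy nQy]]]; split=> //; [left|right; exists y => // /PQ]. Qed.

Lemma sub_interior P Q : P `<=` Q -> interior P `<=` interior Q.
Proof.
by move=> PQ x /interiorP[/PQ Qx nBx Ex]; apply/interiorP; split=> // y /Ex/PQ.
Qed.

Lemma interiorI P Q x : interior P x -> interior Q x -> interior (P `&` Q) x.
Proof.
move=> /interiorP[Px nBx Ex] /interiorP[Qx _ Ex']; apply/interiorP; split=> // y Exy.
by split; [exact: Ex|exact: Ex'].
Qed.

Lemma boundary_or_interior D x : D x -> boundary D x \/ interior D x.
Proof. by case: (pselect (boundary D x)); [left|right]. Qed.

Lemma card_sub S P : S `<=` P -> finite_set P -> card S <= card P.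
Proof.
by move=> SP fP; apply/fsubset_leq_card; rewrite -fset_set_sub //; exact: sub_finite_set fP.
Qed.

Lemma card_sub_eq S P : S `<=` P -> finite_set P -> card P <= card S -> S = P.
Proof.
move=> SP fP le; have fS : finite_set S by exact: sub_finite_set fP.
apply: fset_set_inj => //; apply/eqP; rewrite eqEfcard le andbT.
by rewrite -fset_set_sub.
Qed.

Lemma card_UI P Q : finite_set P -> finite_set Q ->
  card (P `|` Q) + card (P `&` Q) = card P + card Q.
Proof. by move=> fP fQ; rewrite /card fset_setU // fset_setI // cardfsUI. Qed.

Lemma card_seq (s : seq W) : uniq s -> card [set` s] = size s.
Proof.
move=> Us; apply/perm_size/uniq_perm => // y.
by rewrite in_fset_set //; apply/idP/idP; rewrite inE.
Qed.

Lemma cardD1 S x : finite_set S -> S x -> card S = (card (S `\ x)).+1.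
Proof.
move=> fS Sx; rewrite /card fset_setD1 // (cardfsD1 x (fset_set S)).
by rewrite in_fset_set // mem_set.
Qed.

Lemma card_image (h : W -> W) S : finite_set S -> set_inj S h -> card (h @` S) = card S.
Proof.
move=> fS hinj; rewrite /card fset_set_image // card_in_imfset //= => x y.
by rewrite !in_fset_set // => xS yS; apply: hinj.
Qed.

Lemma walk_crosses (f : nat -> W) D i j : i <= j ->
  (forall k, i <= k < j -> E (f k) (f k.+1)) -> D (f i) -> ~ interior D (f j) ->
  exists k, [/\ i <= k <= j, boundary D (f k) &
    forall l, i <= l < k -> interior D (f l)].
Proof.
move=> le_ij; move: (subnKC le_ij); move: (j - i) => d; elim: d i le_ij => [|d IH] i le_ij.
  rewrite addn0 => def_j Ef Di nDj.
  case: (boundary_or_interior Di) => [bd|]; last by rewrite def_j.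
  by exists i; split=> //; [lia|move=> l; lia].
rewrite addnS => def_j Ef Di nDj; case: (boundary_or_interior Di) => [bd|int].
  by exists i; split=> //; [lia|move=> l; lia].
have [|||||k [lek bd kmin]] := IH i.+1 => //.
- lia.
- by move=> k lek; apply: Ef; lia.
- have /interiorP[_ _] := int; apply; apply: Ef; lia.
exists k; split=> //; first lia; move=> l lel.
have [<- //|ne] := eqVneq i l; apply: kmin; lia.
Qed.

(* The path starting at [a] is [f a 0, ..., f a (n a)]. *)
Definition linked_in S D (f : W -> nat -> W) (n : W -> nat) :=
  [/\ forall a, S a -> f a 0 = a,
      forall a i, S a -> i < n a -> E (f a i) (f a i.+1) /\ interior D (f a i),
      forall a, S a -> boundary D (f a (n a)) &
      forall a b i j, S a -> S b -> i <= n a -> j <= n b -> f a i = f b j ->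
        a = b /\ i = j].

Hypothesis A_linkable : forall S, S `<=` A -> finite_set S -> linkable E S B.

(** Each path of a linkage to [B] is cut at its first vertex on the boundary of [D], which exists
    because vertices of [B] are never interior. *)
Lemma exists_linked_in S D : S `<=` A `&` D -> finite_set S -> exists f n, linked_in S D f n.
Proof.
move=> SAD fS; have [|P [trP PP]] := A_linkable (S := S) _ fS.
  by move=> a /SAD[].
pose f a i := nth a (P a) i.
have fP a : S a -> [/\ f a 0 = a, forall i, i.+1 < size (P a) -> E (f a i) (f a i.+1),
    0 < size (P a), B (f a (size (P a)).-1) & uniq (P a)].
  move=> Sa; have [y By] := PP a Sa; rewrite /f /dipath.
  case: (P a) => // z q /and4P[/eqP-> /eqP def_y Eq U]; split=> //=.
    by move=> i lt_i; apply: (pathP a Eq).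
  by rewrite nth_last /= def_y.
have cross a : exists k, S a -> [/\ k < size (P a), boundary D (f a k) &
    forall l, l < k -> interior D (f a l)].
  case: (pselect (S a)) => [Sa|]; last by exists 0.
  have [fa0 Ef gt0 Bl U] := fP a Sa.
  have [||||k [lek bd kmin]] := @walk_crosses (f a) D 0 (size (P a)).-1 => //.
  - by move=> k lek; apply: Ef; lia.
  - by rewrite fa0; have [] := SAD a Sa.
  - by move=> /interiorP[].
  by exists k => _; split=> //; lia.
have [n nP] := choice cross.
exists f, n; split.
- by move=> a /fP[].
- move=> a i Sa lt_i; have [_ Ef _ _ _] := fP a Sa; have [lt_n _ int] := nP a Sa.
  by split; [apply: Ef; lia|exact: int].
- by move=> a /nP[].
move=> a b i j Sa Sb le_i le_j eq_f.
have [_ _ _ _ Ua] := fP a Sa; have [lt_a _ _] := nP a Sa; have [lt_b _ _] := nP b Sb.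
have eq_ab : a = b.
  apply: trP => //; exists (f a i); split=> /=.
    by apply/mem_nth/(leq_ltn_trans le_i).
  by rewrite eq_f; apply/mem_nth/(leq_ltn_trans le_j).
split=> //; subst b; apply/eqP; rewrite -(nth_uniq a _ _ Ua) ?[nth _ _ _]eq_f //.
- exact: leq_ltn_trans le_i lt_a.
- exact: leq_ltn_trans le_j lt_b.
Qed.

(** The cut paths end in distinct boundary vertices. This bounds all finite sets of vertices of [A]
    in [D] uniformly, whence the finiteness. *)
Lemma card_le_boundary D : finite_set (boundary D) ->
  finite_set (A `&` D) /\ card (A `&` D) <= card (boundary D).
Proof.
move=> fbd.
have le S : S `<=` A `&` D -> finite_set S -> card S <= card (boundary D).
  move=> SAD fS; have [f [n [_ _ bd dis]]] := exists_linked_in SAD fS.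
  rewrite -(@card_image (fun a => f a (n a))) //; last first.
    by move=> a b /set_mem Sa /set_mem Sb /dis[].
  by apply: card_sub => // _ [a Sa <-]; exact: bd.
have fAD : finite_set (A `&` D).
  apply: contrapT => /(infinite_set_fset (card (boundary D)).+1)[S SAD].
  have := le [set` S] SAD (finite_fset S); rewrite /card set_fsetK => h1 h2.
  by have := leq_trans h2 h1; rewrite ltnn.
by split=> //; exact: le.
Qed.

(** An injection between finite sets of equal size is onto; thus a linkage inside a tight set uses
    up the whole boundary. *)
Lemma tight_onto P (h : W -> W) : tight P -> set_inj (A `&` P) h ->
  (forall a, A a -> P a -> boundary P (h a)) ->
  forall x, boundary P x -> exists2 a, (A `&` P) a & h a = x.
Proof.
move=> [fA fbd eqc] hinj hbd x.
rewrite -(@card_sub_eq (h @` (A `&` P)) (boundary P)) //.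
  by move=> _ [a [Aa Pa] <-]; exact: hbd.
by rewrite card_image // eqc.
Qed.

(** From [P] to [Q] the vertices of [A] do not decrease and the boundary does not grow, so
    [card_le_boundary] for [Q] leaves only equality. *)
Lemma tight_sup P Q : tight P -> P `<=` Q -> boundary Q `<=` boundary P -> tight Q.
Proof.
move=> [fA fbd eqc] PQ bdQP.
have fbdQ : finite_set (boundary Q) by exact: sub_finite_set fbd.
have [fAQ leQ] := card_le_boundary fbdQ; split=> //.
have le1 := card_sub bdQP fbd.
have le2 : card (A `&` P) <= card (A `&` Q) by apply: card_sub => // a [? /PQ].
lia.
Qed.

Lemma tight0 : tight set0.
Proof.
have b0 : boundary set0 = set0 by apply/seteqP; split=> // x [].
by split; rewrite ?setI0 ?b0.
Qed.

(** Union and intersection together have at most as many boundary vertices as [P] and [Q] together,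
    and exactly as many vertices of [A]. So [card_le_boundary] is an equality for both, and then the
    inclusions [sU] and [sI] are equalities as well. *)
Lemma tight_UI P Q : tight P -> tight Q ->
  [/\ tight (P `|` Q), tight (P `&` Q),
      boundary P `|` boundary Q = boundary (P `|` Q) `|` boundary (P `&` Q) &
      boundary P `&` boundary Q = boundary (P `|` Q) `&` boundary (P `&` Q)].
Proof.
move=> [fAP fbP eqP] [fAQ fbQ eqQ].
have sU : boundary (P `|` Q) `|` boundary (P `&` Q) `<=` boundary P `|` boundary Q.
  move=> x [bx|[[Px Qx] []]].
  - have [[Px|Qx] _] := bx.
      by left; apply: sub_boundary bx => // y; left.
    by right; apply: sub_boundary bx => // y; right.
  - by move=> Bx; left; split=> //; left.
  move=> [y Exy nPQ]; case: (pselect (P y)) => Py.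
    by right; split=> //; right; exists y => // Qy; exact: nPQ.
  by left; split=> //; right; exists y.
have sI : boundary (P `|` Q) `&` boundary (P `&` Q) `<=` boundary P `&` boundary Q.
  move=> x [bx [[Px Qx] _]].
  split; first by apply: sub_boundary bx => // y; left.
  by apply: sub_boundary bx => // y; right.
have fU : finite_set (boundary P `|` boundary Q) by rewrite finite_setU.
have fI : finite_set (boundary P `&` boundary Q) by exact: finite_setIl.
have fbU : finite_set (boundary (P `|` Q)).
  by apply: sub_finite_set fU => x bx; apply: sU; left.
have fbI : finite_set (boundary (P `&` Q)).
  by apply: sub_finite_set fU => x bx; apply: sU; right.
have [fAU leU] := card_le_boundary fbU; have [fAI leI] := card_le_boundary fbI.
have cA := card_UI fAP fAQ; have cb := card_UI fbP fbQ; have cbUI := card_UI fbU fbI.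
have leU' := card_sub sU fU; have leI' := card_sub sI fI.
rewrite -setIUr -setIIr in cA.
split.
- split=> //; lia.
- split=> //; lia.
- by apply/esym/card_sub_eq => //; lia.
by apply/esym/card_sub_eq => //; lia.
Qed.

(** * How a linkage of a set crosses a tight subset *)

Section Crossing.
Variables (D P : set W) (f : W -> nat -> W) (n : W -> nat).
Hypotheses (f_linked : linked_in (A `&` D) D f n) (P_tight : tight P) (PD : P `<=` D).

Lemma linked_last_notin_interior a : (A `&` D) a -> ~ interior P (f a (n a)).
Proof.
move=> Aa /(sub_interior PD) [_]; apply; have [_ _ bd _] := f_linked; exact: bd.
Qed.

Lemma linked_crosses a : A a -> P a -> exists k, [/\ k <= n a, boundary P (f a k) &
  forall l, l < k -> interior P (f a l)].
Proof.
move=> Aa Pa; have ADa : (A `&` D) a by split=> //; exact: PD.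
have [f0 Ef bd _] := f_linked.
have [||||k [lek bk kmin]] := @walk_crosses (f a) P 0 (n a) => //.
- by move=> k lek; have [] := Ef a k ADa.
- by rewrite f0.
- exact: linked_last_notin_interior.
by exists k; split.
Qed.

(** The first crossings of the paths starting in [P] are distinct, so by tightness they exhaust the
    boundary of [P]. As the paths are disjoint, no path meets that boundary twice, or at all without
    starting in [P]. *)
Lemma linked_boundary x : boundary P x -> exists b k,
  [/\ A b, P b, k <= n b, f b k = x &
      forall c j, (A `&` D) c -> j <= n c -> f c j = x ->
        c = b /\ forall i, i <= n c -> boundary P (f c i) -> i = j].
Proof.
move=> bx; have [_ _ _ dis] := f_linked.
have AD a : A a -> P a -> (A `&` D) a by move=> Aa /PD.
have /choice[k kP] : forall a, exists k, A a -> P a -> k <= n a /\ boundary P (f a k).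
  move=> a; case: (pselect (A a /\ P a)) => [[Aa Pa]|nAP]; last first.
    by exists 0 => Aa Pa; case: nAP.
  by have [k [lek bk _]] := linked_crosses Aa Pa; exists k.
have h_inj : set_inj (A `&` P) (fun a => f a (k a)).
  move=> a b /set_mem[Aa Pa] /set_mem[Ab Pb].
  have [lea _] := kP a Aa Pa; have [leb _] := kP b Ab Pb.
  by case/(dis _ _ _ _ (AD a Aa Pa) (AD b Ab Pb) lea leb).
have key y : boundary P y -> exists2 b, [/\ A b, P b, k b <= n b & f b (k b) = y] &
    forall c j, (A `&` D) c -> j <= n c -> f c j = y -> c = b /\ j = k b.
  move=> /(tight_onto P_tight h_inj (fun a Aa Pa => proj2 (kP a Aa Pa)))[b [Ab Pb] def_y].
  have [leb _] := kP b Ab Pb; exists b => // c j Ac lej fcj.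
  by apply: dis => //; [exact: AD|rewrite fcj def_y].
have [b [Ab Pb leb fb] buniq] := key x bx.
exists b, (k b); split=> // c j Ac lej fcj; have [eq_cb ->] := buniq c j Ac lej fcj.
split=> // i lei bi; have [b' _ b'uniq] := key _ bi.
have [eq_cb' ->] := b'uniq c i Ac lei erefl.
by rewrite -eq_cb' eq_cb.
Qed.

Lemma linked_onto x : boundary P x ->
  exists a k, [/\ A a, P a, k <= n a & f a k = x].
Proof. by move=> /linked_boundary[b [k [? ? ? ? _]]]; exists b, k. Qed.

Lemma linked_boundary_unique b i : (A `&` D) b -> i <= n b -> boundary P (f b i) ->
  P b /\ forall j, j <= n b -> boundary P (f b j) -> j = i.
Proof.
move=> ADb lei /linked_boundary[c [k [_ Pc _ _ /(_ b i ADb lei erefl)[-> uniq_i]]]].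
by split.
Qed.

(** A path in [P] at time [j] meets the boundary at or after [j], since its end is not interior to
    [P]. Then it started in [P], so it also met the boundary at or before [i]: once too often. *)
Lemma linked_leaves b i j : (A `&` D) b -> i < j <= n b ->
  ~ P (f b i) \/ boundary P (f b i) -> ~ P (f b j).
Proof.
move=> ADb le_ij out Pj; have [f0 Ef bd _] := f_linked.
have [||||k [lek bk _]] := @walk_crosses (f b) P j (n b) => //.
- lia.
- by move=> k lek; have [] := Ef b k ADb; first lia.
- exact: linked_last_notin_interior.
have [||Pb uniq_k] := linked_boundary_unique (i := k) ADb; [lia|by []|].
case: out => [nPi|bi]; last by have := uniq_k i _ bi; lia.
have [||||l [lel bl _]] := @walk_crosses (f b) P 0 i => //.
- by move=> l lel; have [] := Ef b l ADb; first lia.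
- by rewrite f0.
- by case.
have := uniq_k l _ bl; lia.
Qed.

End Crossing.

Lemma linked_mem S D f n a i : linked_in S D f n -> S a -> i <= n a -> D (f a i).
Proof.
move=> [_ Ef bd _] Sa; rewrite leq_eqVlt => /predU1P[->|lt_i].
  by have [] := bd a Sa.
by have [_ []] := Ef a i Sa lt_i.
Qed.

(** * Linkages given by a relation *)

Implicit Types (U : set W) (M : W -> W -> Prop).

Definition links M P := forall a, A a -> P a -> exists (n : nat) (f : nat -> W),
  [/\ f 0 = a, forall i, i < n -> M (f i) (f i.+1) /\ interior P (f i) &
      boundary P (f n)].

Lemma links_mono M M' P : (forall x y, M x y -> M' x y) -> links M P -> links M' P.
Proof.
move=> MM' lk a Aa Pa; have [n [f [f0 Ef bd]]] := lk a Aa Pa.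
by exists n, f; split=> // i /Ef[/MM'].
Qed.

Lemma links_sub M P Q : (forall x y, M x y -> E x y) -> P `<=` Q ->
  links M Q -> links M P.
Proof.
move=> ME PQ lk a Aa Pa; have [n [f [f0 Mf bd]]] := lk a Aa (PQ a Pa).
have [||||k [lek bk kmin]] := @walk_crosses f P 0 n => //.
- by move=> k lek; have [/ME] := Mf k lek.
- by rewrite f0.
- by move=> /(sub_interior PQ)[].
exists k, f; split=> // i lti; split; last exact: kmin.
by have [] := Mf i; first lia.
Qed.

(** The disjointness missing from [links] comes from here: trajectories from [A] with a common
    vertex are traced back in parallel, and neither reaches its start before the other because no
    arrow enters [A]. *)
Definition linear_rel M :=
  [/\ forall x y, M x y -> E x y, forall x y, M x y -> ~ A y,
      forall x y z, M x y -> M x z -> y = z &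
      forall x y z, M x z -> M y z -> x = y].

Lemma trajectory_eq M (f g : nat -> W) n : linear_rel M -> f 0 = g 0 ->
  (forall i, i < n -> M (f i) (f i.+1)) -> (forall i, i < n -> M (g i) (g i.+1)) ->
  forall i, i <= n -> f i = g i.
Proof.
move=> [_ _ func _] fg0 Mf Mg; elim=> // i IH lti.
by apply: func (Mf i lti) _; rewrite IH ?(ltnW lti) //; exact: Mg.
Qed.

Lemma trajectory_back M (f g : nat -> W) i j : linear_rel M -> A (f 0) -> A (g 0) ->
  (forall k, k < i -> M (f k) (f k.+1)) -> (forall k, k < j -> M (g k) (g k.+1)) ->
  f i = g j -> i = j /\ f 0 = g 0.
Proof.
move=> [_ notA _ inj] Af Ag; elim: i j => [|i IH] [|j] Mf Mg eq_fg //.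
- by case: (notA _ _ (Mg j _)) => //; rewrite -eq_fg.
- by case: (notA _ _ (Mf i _)) => //; rewrite eq_fg.
have Mi := Mf i (ltnSn i); rewrite eq_fg in Mi.
have [|||-> ->] := IH j => //.
- by move=> k ltk; apply: Mf; lia.
- by move=> k ltk; apply: Mg; lia.
exact: inj Mi (Mg j (ltnSn j)).
Qed.

Lemma links_onto M P : linear_rel M -> tight P -> links M P -> forall x, boundary P x ->
  exists n f, [/\ A (f 0), P (f 0), f n = x &
    forall i, i < n -> M (f i) (f i.+1) /\ interior P (f i)].
Proof.
move=> Mlin tP lk x bx.
have /choice[h hP] : forall a, exists nf : nat * (nat -> W), A a -> P a ->
    [/\ nf.2 0 = a, forall i, i < nf.1 -> M (nf.2 i) (nf.2 i.+1) /\ interior P (nf.2 i) &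
      boundary P (nf.2 nf.1)].
  move=> a; case: (pselect (A a /\ P a)) => [[Aa Pa]|nAP]; last first.
    by exists (0, fun=> a) => Aa Pa; case: nAP.
  by have [n [f fP]] := lk a Aa Pa; exists (n, f).
have [||a [Aa Pa] def_x] := tight_onto (h := fun a => (h a).2 (h a).1) tP _ _ bx.
- move=> a b /set_mem[Aa Pa] /set_mem[Ab Pb].
  have [fa Ma _] := hP a Aa Pa; have [fb Mb _] := hP b Ab Pb => eq_ab.
  rewrite -{}fa in Aa *; rewrite -{}fb in Ab *.
  by case: (trajectory_back Mlin Aa Ab _ _ eq_ab) => // k; [move=> /Ma[]|move=> /Mb[]].
- by move=> a Aa Pa; have [] := hP a Aa Pa.
have [fa Ma ba] := hP a Aa Pa.
by exists (h a).1, (h a).2; split; rewrite ?fa.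
Qed.

Lemma links_setU M P Q : linear_rel M -> tight P -> tight Q ->
  links M P -> links M Q -> links M (P `|` Q).
Proof.
move=> Mlin.
(* If the trajectory of [a] reaches the boundary of [P'] at a point interior to
   the union, then [a] lies in [Q'] and the trajectory goes on to the boundary of
   [Q']; were that point interior to the union as well, both points would be the
   end of the trajectory of [a] in [P' `&` Q']. *)
suff half P' Q' a : tight P' -> tight Q' -> links M P' -> links M Q' -> A a -> P' a ->
    exists (n : nat) (f : nat -> W),
      [/\ f 0 = a, forall i, i < n -> M (f i) (f i.+1) /\ interior (P' `|` Q') (f i) &
        boundary (P' `|` Q') (f n)].
  move=> tP tQ lP lQ a Aa [Pa|Qa]; first exact: half.
  by rewrite setUC; exact: half.
move=> tP tQ lP lQ Aa Pa; have [tU tI bdU bdI] := tight_UI tP tQ.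
have [ME _ _ _] := Mlin.
have lI : links M (P' `&` Q') by apply: links_sub lP => // x [].
have [n [f [f0 Mf bf]]] := lP a Aa Pa.
have sPU := sub_interior (@subsetUl _ P' Q'); have sQU := sub_interior (@subsetUr _ P' Q').
case: (pselect (boundary (P' `|` Q') (f n))) => [bU|nbU].
  by exists n, f; split=> // i /Mf[? /sPU].
have bI : boundary (P' `&` Q') (f n).
  have : (boundary P' `|` boundary Q') (f n) by left.
  by rewrite bdU => -[].
have [m [g [Ag [Pg Qg] gm Mg]]] := links_onto Mlin tI lI bI.
have Af : A (f 0) by rewrite f0.
have Mf' k : k < n -> M (f k) (f k.+1) by move=> /Mf[].
have Mg' k : k < m -> M (g k) (g k.+1) by move=> /Mg[].
have [eq_mn g0] := trajectory_back Mlin Ag Af Mg' Mf' gm; subst m.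
have fg := trajectory_eq Mlin g0 Mg' Mf'.
have Qa : Q' a by rewrite -f0 -g0.
have [k [h [h0 Mh bh]]] := lQ a Aa Qa.
have Mh' l : l < k -> M (h l) (h l.+1) by move=> /Mh[].
have hf0 : h 0 = f 0 by rewrite f0.
(* Stopping at [f n] would put it on both boundaries, hence on that of the union; stopping earlier
   would be at an interior vertex of the intersection, hence of [Q']. *)
have lt_nk : n < k.
  rewrite ltnNge; apply/negP => le_kn.
  have hfk : h k = f k.
    by apply: (trajectory_eq Mlin hf0 Mh' _ (leqnn k)) => i lti; apply: Mf'; lia.
  move: le_kn; rewrite leq_eqVlt => /predU1P[eq_kn|lt_kn].
    have : (boundary P' `&` boundary Q') (f n).
      by split=> //; rewrite -eq_kn -hfk.
    by rewrite bdI => -[].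
  have [_ int] := Mg k lt_kn.
  have [_] : interior Q' (g k) by apply: sub_interior int => // x [].
  by rewrite fg ?(ltnW lt_kn) // -hfk; apply.
exists k, h; split=> // [i lti|]; first by have [? /sQU] := Mh i lti.
apply: contrapT => nbUk.
have bIk : boundary (P' `&` Q') (h k).
  have : (boundary P' `|` boundary Q') (h k) by right.
  by rewrite bdU => -[].
have [m [g' [Ag' [Pg' Qg'] gm' Mg'']]] := links_onto Mlin tI lI bIk.
have Ah : A (h 0) by rewrite h0.
have Mgg k' : k' < m -> M (g' k') (g' k'.+1) by move=> /Mg''[].
have [eq_mk g0'] := trajectory_back Mlin Ag' Ah Mgg Mh' gm'; subst m.
have gh := trajectory_eq Mlin g0' Mgg Mh'.
have [_ [_]] := Mg'' n lt_nk; rewrite gh ?(ltnW lt_nk) //.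
rewrite (_ : h n = f n) //.
by apply: (trajectory_eq Mlin hf0 _ Mf' (leqnn n)) => i lti; apply: Mh'; lia.
Qed.

(** * Linking all tight sets simultaneously *)

Lemma finite_sub_chain T (G : set T) (H : T -> set W) S : G !=set0 ->
  (forall i j, G i -> G j -> H i `<=` H j \/ H j `<=` H i) ->
  finite_set S -> S `<=` \bigcup_(i in G) H i -> exists2 i, G i & S `<=` H i.
Proof.
move=> [i0 Gi0] chain /finite_seqP[s ->]; elim: s => [|x s IH] sub; first by exists i0.
have [|i Gi sHi] := IH; first by move=> y ys; apply: sub; rewrite /= inE ys orbT.
have [j Gj Hjx] := sub x (mem_head x s).
have [ij|ji] := chain i j Gi Gj.
  by exists j => // y /=; rewrite inE => /predU1P[->//|/sHi/ij].
by exists i => // y /=; rewrite inE => /predU1P[->|/sHi//]; exact: ji.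
Qed.

(** A boundary vertex of the union is a boundary vertex of every member containing it, and no member
    has more of them than [D] has vertices of [A]. So the boundary of the union is finite, and one
    member contains it together with all vertices of [A] in the union. *)
Lemma tight_chain T (G : set T) (H : T -> set W) D : tight D -> G !=set0 ->
  (forall i j, G i -> G j -> H i `<=` H j \/ H j `<=` H i) ->
  (forall i, G i -> tight (H i)) -> (forall i, G i -> H i `<=` D) ->
  let HG := \bigcup_(i in G) H i in
  tight HG /\ exists i, [/\ G i, A `&` HG `<=` H i & boundary HG = boundary (H i)].
Proof.
move=> [fAD _ _] G0 chain tH HD HG.
have sH i : G i -> H i `<=` HG by move=> Gi x Hx; exists i.
have leH i : G i -> card (A `&` H i) <= card (A `&` D).
  by move=> Gi; apply: card_sub => // x [Ax /(HD i Gi)].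
have fb : finite_set (boundary HG).
  apply: contrapT => /(infinite_set_fset (card (A `&` D)).+1)[X Xb leX].
  have [i Gi Xi] : exists2 i, G i & [set` X] `<=` H i.
    by apply: finite_sub_chain => // x /Xb[].
  have [_ fbi eqi] := tH i Gi.
  have := @card_sub [set` X] (boundary (H i)) _ fbi.
  rewrite -eqi /card set_fsetK => leXb; have := leH i Gi.
  have : #|` X| <= card (A `&` H i).
    by apply: leXb => x Xx; apply: sub_boundary (sH i Gi) (Xi x Xx) (Xb x Xx).
  by move: leX; rewrite /card; lia.
have fA : finite_set (A `&` HG).
  by apply: sub_finite_set fAD => x [Ax [i Gi /(HD i Gi)]].
have [i Gi Hi] : exists2 i, G i & (A `&` HG) `|` boundary HG `<=` H i.
  by apply: finite_sub_chain => //; [rewrite finite_setU|move=> x [[_ //]|[]]].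
have bi : boundary HG `<=` boundary (H i).
  by move=> x bx; have Hx : H i x by [apply: Hi; right]; exact: sub_boundary (sH i Gi) Hx bx.
have tHG : tight HG by exact: tight_sup (tH i Gi) (sH i Gi) bi.
split=> //; exists i; split=> //; first by move=> x Ax; apply: Hi; left.
have [_ fbi eqi] := tH i Gi; have [_ _ eqG] := tHG.
apply: card_sub_eq => //; rewrite -eqi -eqG; apply: card_sub => //.
by move=> x [Ax /(sH i Gi)].
Qed.

(** [U] may contain infinitely many vertices of [A], and then is not tight; its traces on tight sets
    take its place. *)
Definition partial_linkage U M :=
  [/\ linear_rel M, forall x y, M x y -> interior U x,
      forall D, tight D -> tight (D `&` U) & forall D, tight D -> links M (D `&` U)].

(** To [M] are added the arrows of a linkage of [D] that start outside the interior of [U]. By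
    [linked_leaves] they also end outside [U], so they do not clash with [M]. *)
Lemma partial_linkage_extend U M D : partial_linkage U M -> tight D ->
  exists M', partial_linkage (U `|` D) M' /\ forall x y, M x y -> M' x y.
Proof.
move=> [[ME notA func inj] Mint tU lU] tD.
have [|f [n fl]] := @exists_linked_in (A `&` D) D (fun x h => h); first by case: tD.
have [f0 Ef bf dis] := fl.
have tR := tU D tD; set R := D `&` U in tR.
have RD : R `<=` D by move=> x [].
have leaves a i j : (A `&` D) a -> i < j <= n a -> ~ interior U (f a i) -> ~ U (f a j).
  move=> ADa leij nint Uj.
  apply: (linked_leaves fl tR RD ADa leij); last first.
    by split=> //; apply: linked_mem fl ADa _; lia.
  case: (pselect (U (f a i))) => Ui; [right|left; case=> //].
  apply: contrapT => nb; apply: nint; apply: (@sub_interior R); first by move=> x [].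
  by split=> //; split=> //; apply: linked_mem fl ADa _; lia.
pose N x y := exists a i, [/\ (A `&` D) a, i < n a, f a i = x, f a i.+1 = y &
  ~ interior U x].
pose M' x y := M x y \/ N x y.
have M'lin : linear_rel M'.
  split.
  - by move=> x y [/ME//|[a [i [Aa lti <- <- _]]]]; have [] := Ef a i Aa lti.
  - move=> x y [/notA//|[a [i [ADa lti _ <- _]]]] Aw.
    have ADw : (A `&` D) (f a i.+1) by split=> //; exact: linked_mem fl ADa lti.
    by have [] := dis _ _ _ _ ADa ADw lti (leq0n _) (esym (f0 _ ADw)).
  - move=> x y z [Mxy|[a [i [ADa lti fx fy nint]]]] [Mxz|[b [j [ADb ltj fx' fz nint']]]].
    + exact: func Mxy Mxz.
    + by case: nint'; exact: Mint Mxy.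
    + by case: nint; exact: Mint Mxz.
    have eqx : f a i = f b j by rewrite fx fx'.
    have [eq_ab eq_ij] := dis _ _ _ _ ADa ADb (ltnW lti) (ltnW ltj) eqx.
    by rewrite -fy -fz eq_ab eq_ij.
  have NU x y : N x y -> ~ U y.
    by move=> [a [i [ADa lti <- <- nint]]]; apply: leaves ADa _ nint; rewrite ltnSn.
  have MU x y : M x y -> U y by move=> Mxy; have /interiorP[_ _] := Mint _ _ Mxy; apply; exact: ME.
  move=> x y z [Mxz|Nxz] [Myz|Nyz].
  - exact: inj Mxz Myz.
  - by case: (NU _ _ Nyz); exact: MU Mxz.
  - by case: (NU _ _ Nxz); exact: MU Myz.
  have [a [i [ADa lti <- fz _]]] := Nxz; have [b [j [ADb ltj <- fz' _]]] := Nyz.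
  have eqz : f a i.+1 = f b j.+1 by rewrite fz fz'.
  by have [-> [->]] := dis _ _ _ _ ADa ADb lti ltj eqz.
have lD : links M' D.
  move=> a Aa Da; have ADa : (A `&` D) a by [].
  case: (pselect (U a)) => Ua; last first.
    exists (n a), (f a); split; rewrite ?f0 //; last exact: bf.
    move=> i lti; have [Ei inti] := Ef a i ADa lti; split=> //; right.
    exists a, i; split=> //; case: (posnP i) => [->|i0]; first by rewrite f0 // => -[].
    have out0 : ~ interior U (f a 0) by rewrite f0 // => -[].
    by move=> /interiorP[Ui _ _]; apply: (leaves a 0 i) => //; rewrite i0 ltnW.
  have [m [g [g0 Mg bg]]] := lU D tD a Aa (conj Da Ua).
  (* The old trajectory ends on the boundary of [R], all of which is covered by the linkage of [D];
     the path found there is followed to the boundary of [D]. *)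
  have [b [k [Ab [Db Ub] lek fbk]]] := linked_onto fl tR RD bg.
  have ADb : (A `&` D) b by [].
  exists (m + (n b - k)), (fun i => if i < m then g i else f b (k + (i - m))); split.
  - by case: (posnP m) => [m0|//]; rewrite m0 sub0n addn0 fbk m0 g0.
  - move=> i lti; case: ltnP => [ltim|leim].
      have [Mi inti] := Mg i ltim; split; last exact: sub_interior RD _ inti.
      left; case: ltnP => // lemi; have -> : i.+1 = m by lia.
      by rewrite subnn addn0 fbk (_ : m = i.+1) //; lia.
    rewrite ltnNge (leqW leim) /= subSn // addnS.
    have ltk : k + (i - m) < n b by lia.
    have [Ei inti] := Ef b _ ADb ltk; split=> //; right.
    (* At [i = m] the vertex is interior to [D] but on the boundary of [R], so not interior to [U];
       later vertices lie in [D] but outside [R], so outside [U]. *)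
    exists b, (k + (i - m)); split=> // intU.
    have bR : boundary R (f b k) by rewrite fbk.
    have [eq_im|ltim] := eqVneq i m.
      move: inti intU; rewrite eq_im subnn addn0 => inti intU.
      by have [_] := interiorI inti intU.
    have [Ui _] := intU; have RDi : R (f b (k + (i - m))).
      by split=> //; apply: linked_mem fl ADb _; lia.
    by apply: (linked_leaves fl tR RD ADb _ (or_intror bR) RDi); lia.
  - by rewrite ltnNge leq_addr /= addKn subnKC //; exact: bf.
have MM' x y : M x y -> M' x y by left.
exists M'; split=> //; split=> //.
- move=> x y [/Mint|[a [i [ADa lti <- _ _]]]]; first exact: sub_interior (@subsetUl _ U D) _.
  by have [_] := Ef a i ADa lti; exact: sub_interior (@subsetUr _ U D) _.
- move=> D' tD'; rewrite setIUr.
  by have [] := tight_UI (tU D' tD') (let: And4 _ t _ _ := tight_UI tD' tD in t).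
move=> D' tD'; rewrite setIUr; apply: links_setU => //.
- exact: tU.
- by have [] := tight_UI tD' tD.
- exact: links_mono MM' (lU D' tD').
- by apply: links_sub lD => [x y|x []//]; have [ME' _ _ _] := M'lin; exact: ME'.
Qed.

Lemma exists_full_linkage : exists U M, partial_linkage U M /\ forall D, tight D -> D `<=` U.
Proof.
(* A set in the sum type encodes the pair [(U, M)], ordered by inclusion. *)
pose Us (Z : set (W + W * W)) : set W := fun x => Z (inl x).
pose Ms (Z : set (W + W * W)) x y := Z (inr (x, y)).
have [F FPL chain|Z [PLZ Zmax]] :=
  @Zorn_bigcup (W + W * W)%type (fun Z => partial_linkage (Us Z) (Ms Z)).
  set Z := \bigcup_(X in F) X.
  have UsZ D : D `&` Us Z = \bigcup_(X in F) (D `&` Us X).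
    apply/seteqP; split=> [x [Dx [X FX Xx]]|x [X FX [Dx Xx]]]; first by exists X.
    by split=> //; exists X.
  have two X Y : F X -> F Y -> exists2 T, F T & X `<=` T /\ Y `<=` T.
    by move=> FX FY; case: (chain X Y FX FY) => ?;
      [exists Y|exists X] => //; split=> // ?.
  have Zlin : linear_rel (Ms Z).
    split.
    - by move=> x y [X FX Xxy]; have [[ME _ _ _] _ _ _] := FPL X FX; exact: ME Xxy.
    - by move=> x y [X FX Xxy]; have [[_ nA _ _] _ _ _] := FPL X FX; exact: nA Xxy.
    - move=> x y z [X FX Xxy] [Y FY Yxz]; have [T FT [XT YT]] := two X Y FX FY.
      by have [[_ _ fn _] _ _ _] := FPL T FT; exact: fn (XT _ Xxy) (YT _ Yxz).
    - move=> x y z [X FX Xxy] [Y FY Yxz]; have [T FT [XT YT]] := two X Y FX FY.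
      by have [[_ _ _ inj] _ _ _] := FPL T FT; exact: inj (XT _ Xxy) (YT _ Yxz).
  split=> // [x y [X FX Xxy]|D tD|D tD].
  - have [_ Mint _ _] := FPL X FX.
    by apply: sub_interior (Mint x y Xxy) => z Xz; exists X.
  - rewrite UsZ; case: (pselect (F !=set0)) => [F0|nF].
      have [|||tHG _] := @tight_chain _ F (fun X => D `&` Us X) D tD F0; last exact: tHG.
      + move=> X Y FX FY; have [XY|YX] := chain X Y FX FY; [left|right];
          move=> x [? ?]; split=> //; by [apply: XY|apply: YX].
      + by move=> X FX; have [_ _ tU _] := FPL X FX; exact: tU.
      + by move=> X FX x [].
    rewrite (_ : bigcup _ _ = set0); first exact: tight0.
    by apply/seteqP; split=> // x [X FX _]; case: nF; exists X.
  (* The trace on [D] of some member [X] of the chain has the same vertices of [A] and the same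
     boundary as that of the union, so its trajectories serve. *)
  - move=> a Aa HGa; have [Da [X0 FX0 _]] := HGa; rewrite UsZ in HGa *.
    have [||||_ [X [FX AX bX]]] := @tight_chain _ F (fun X => D `&` Us X) D tD.
    + by exists X0.
    + move=> X Y FX FY; have [XY|YX] := chain X Y FX FY; [left|right];
        move=> x [? ?]; split=> //; by [apply: XY|apply: YX].
    + by move=> X FX; have [_ _ tU _] := FPL X FX; exact: tU.
    + by move=> X FX x [].
    have [_ _ _ lX] := FPL X FX.
    have [m [f [f0 Mf bf]]] := lX D tD a Aa (AX a (conj Aa HGa)).
    exists m, f; split=> //; last by rewrite bX.
    move=> i lti; have [Mi inti] := Mf i lti; split; first by exists X.
    by apply: sub_interior inti => x Hx; exists X.
exists (Us Z), (Ms Z); split=> // D tD x Dx.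
apply: contrapT => nUx.
have [M' [PL' MM']] := partial_linkage_extend PLZ tD.
pose Z' : set (W + W * W) := fun t => match t with
  | inl y => (Us Z `|` D) y | inr p => M' p.1 p.2 end.
apply: (Zmax Z'); last first.
  by rewrite (_ : Ms Z' = M') // ; apply/funext => y; apply/funext.
split; first by move=> [y|[y z]] Zy; [left|exact: MM'].
by move=> sub; apply/nUx/(sub (inl x)); right.
Qed.

(** * Reaching the target when interiors of tight sets cover its complement *)

Lemma tight_cover (K : set W -> set W) D (s : seq W) :
  (forall P Q, P `<=` Q -> K P `<=` K Q) -> tight D ->
  (forall x, x \in s -> exists2 P, tight P & K P x) ->
  exists P, [/\ tight P, D `<=` P & forall x, x \in s -> K P x].
Proof.
move=> Kmono tD; elim: s => [|x s IH] cov; first by exists D; split=> // ?.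
have covs y : y \in s -> exists2 P, tight P & K P y.
  by move=> ys; apply: cov; rewrite inE ys orbT.
have [P [tP DP KP]] := IH covs.
have [Q tQ KQ] := cov x (mem_head x s).
have [tU _ _ _] := tight_UI tP tQ.
exists (P `|` Q); split=> // [y /DP|y]; first by left.
rewrite inE => /predU1P[->|/KP].
  exact: Kmono (@subsetUr _ P Q) _ KQ.
exact: Kmono (@subsetUl _ P Q) _.
Qed.

(** The vertex [x] is interior to the enlarged set, which thus gains no boundary vertex. *)
Lemma tight_add D x : tight D -> ~ B x -> (forall y, E x y -> D y) ->
  exists2 P, tight P & interior P x.
Proof.
move=> tD nBx Ex.
have int : interior (D `|` [set x]) x.
  by apply/interiorP; split=> // [|y /Ex]; [right|left].
exists (D `|` [set x]) => //; apply: tight_sup tD (@subsetUl _ _ _) _.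
move=> y bdy; have [[Dy|eq_yx] _] := bdy; first exact: sub_boundary (@subsetUl _ _ _) Dy bdy.
by move: bdy; rewrite eq_yx => bdx; have [_] := int.
Qed.

(** Menger's theorem gives [X] smaller than some finite [S] containing [x]; let [D] be the set of
    all vertices that [X] separates from [B]. Its boundary lies in [X], and it contains [S], whose
    elements other than [x] are in [A]; so [D] is tight. *)
Lemma tight_of_not_linkable x : ~ A x -> (forall y, ~ E y x) ->
  ~ (forall S, S `<=` A `|` [set x] -> finite_set S -> linkable E S B) ->
  exists2 D, tight D & interior D x.
Proof.
move=> nAx nEx /existsNP[S /not_implyP[SAx /not_implyP[fS nlk]]].
have Sx : S x.
  apply: contrapT => nSx; apply: nlk; apply: A_linkable => // y Sy.
  by have [//|eq_yx] := SAx y Sy; rewrite eq_yx in Sy.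
have [s Us eq_s] : exists2 s : seq W, uniq s & S = [set` s].
  exists (fset_set S); first exact: fset_uniq.
  by rewrite -[LHS](fset_setK fS).
have [|[X [ltX sep]]] := menger E B Us; first by rewrite -eq_s.
pose D := [set u | forall p, path E u p -> B (last u p) -> has (mem X) (u :: p)].
have SD : S `<=` D by rewrite eq_s => u us p; exact: sep.
have bdX : boundary D `<=` [set` X].
  move=> u [Du bd]; apply: contrapT => /negP nXu; case: bd => [Bu|[y Euy []]].
    by have := Du [::] isT Bu; rewrite /= orbF => /negPn; rewrite nXu.
  by move=> p Ep Bp; have /= := Du (y :: p); rewrite Euy (negbTE nXu); apply.
have fb : finite_set (boundary D) by apply: sub_finite_set bdX _; exact: finite_seq.
have [fAD leAD] := card_le_boundary fb.
have leb : card (boundary D) <= size X.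
  apply: leq_trans (card_sub bdX (finite_seq X)) _.
  have -> : [set` X] = [set` undup X] by apply/seteqP; split=> y /=; rewrite mem_undup.
  by rewrite card_seq ?undup_uniq // size_undup.
have leS : size s <= (card (A `&` D)).+1.
  rewrite -(card_seq Us) -eq_s (cardD1 fS Sx) ltnS; apply: card_sub => // y [Sy nyx].
  by split; [have [//|/nyx] := SAx y Sy|exact: SD].
have tD : tight D by split=> //; lia.
exists D => //; split; first exact: SD.
(* If [x] were on the boundary, deleting it from [D] would cost a boundary vertex but no vertex of
   [A]; no new boundary vertex arises, as no arrow enters [x]. *)
move=> bx.
have sub' : boundary (D `\ x) `<=` boundary D `\ x.
  move=> u [[Du nux] bd]; split=> //; split=> //; case: bd => [Bu|[y Euy nDy]]; [by left|right].
  by exists y => // Dy; apply: nDy; split=> // eqyx; apply: (nEx u); rewrite -eqyx.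
have [_ leAD'] := card_le_boundary (sub_finite_set sub' (finite_setD _ fb)).
have eqA : A `&` (D `\ x) = A `&` D.
  by apply/seteqP; split=> y [Ay]; [case|move=> Dy]; split=> //; split=> // eqyx; rewrite -eqyx in nAx.
have lt' := cardD1 fb bx.
have le' := card_sub sub' (finite_setD _ fb).
by have [_ _] := tD; rewrite eqA in leAD'; lia.
Qed.

(** A trajectory must reach the boundary of every tight set containing its start. If it stopped
    outside [B], finitely many tight sets would unite to one with the whole trajectory in its
    interior. *)
Lemma linkage_to_closed_target :
  (forall x, ~ B x -> exists2 D, tight D & interior D x) ->
  exists Q : W -> path_or_ray W, trivIset A (@vertices W \o Q) /\
    forall a, A a -> match Q a with
      | FinPath p => dipath_to E a B p
      | Ray r => [/\ diray E r, r 0 = a &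
          forall D, tight D -> exists N, forall n, N <= n -> ~ D (r n)]
      end.
Proof.
move=> cov; have [U [M [[Mlin Mint _ lU] fullU]]] := exists_full_linkage.
have lM D : tight D -> links M D.
  by move=> tD; rewrite -(setIidl (fullU D tD)); exact: lU.
have [ME _ _ _] := Mlin.
have MB x y : M x y -> ~ B x by move=> /Mint/interiorP[].
(* Where [M] offers no successor, [xget] repeats the vertex; [step] tells the genuine arrows. *)
pose r a n := iter n (fun x => xget x (M x)) a.
pose step a i := M (r a i) (r a i.+1).
have rM a i y : M (r a i) y -> step a i.
  by move=> My; rewrite /step /r /=; case: xgetP => [z -> //|] /(_ y).
have r_inj a b i j : A a -> A b -> (forall k, k < i -> step a k) ->
    (forall k, k < j -> step b k) -> r a i = r b j -> i = j /\ a = b.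
  by move=> Aa Ab Sa Sb; exact: (@trajectory_back M (r a) (r b)).
have /choice[Q QP] : forall a, exists q,
    (exists n, [/\ q = FinPath (mkseq (r a) n.+1), forall i, i < n -> step a i &
       forall y, ~ M (r a n) y]) \/
    (q = Ray (r a) /\ forall i, step a i).
  move=> a; case: (pselect (exists n, ~ step a n)) => [ex|nex]; last first.
    by exists (Ray (r a)); right; split=> // i; apply: contrapT => ?; apply: nex; exists i.
  have /ex_minnP[n /asboolP nn nmin] : exists n, `[< ~ step a n >].
    by have [n ?] := ex; exists n; apply/asboolP.
  exists (FinPath (mkseq (r a) n.+1)); left; exists n; split=> //; last first.
    by move=> y /rM.
  move=> i lti; apply: contrapT => ni.
  by have := nmin i; rewrite leqNgt lti => /(_ (asboolT ni)).
have Qv a x : vertices (Q a) x -> exists2 i, x = r a i & forall k, k < i -> step a k.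
  have [[n [-> Sa _]]|[-> Sa]] := QP a => /=.
    by move=> /mapP[i]; rewrite mem_iota => lti ->; exists i => // k ltk; apply: Sa; lia.
  by move=> [i _ <-]; exists i.
exists Q; split.
  move=> a b Aa Ab [x [/Qv[i -> Sa] /Qv[j eq_r Sb]]].
  by have [] := r_inj a b i j Aa Ab Sa Sb eq_r.
move=> a Aa.
have meets D : tight D -> D a -> exists m f, [/\ boundary D (f m), f 0 = a &
    forall i, i < m -> M (f i) (f i.+1)].
  move=> tD Da; have [m [f [f0 Mf bf]]] := lM D tD a Aa Da.
  by exists m, f; split=> // i /Mf[].
have [[n [-> Sa stop]]|[-> Sa]] := QP a.
  have Br : B (r a n).
    apply: contrapT => nB.
    have [x|P [tP _ intP]] := tight_cover (s := mkseq (r a) n.+1) sub_interior tight0.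
      move=> /mapP[i]; rewrite mem_iota => lti ->; apply: cov.
      by have [->//|ne] := eqVneq i n; apply/MB/Sa; lia.
    have int i : i <= n -> interior P (r a i).
      by move=> lei; apply: intP; apply/mapP; exists i => //; rewrite mem_iota; lia.
    have [m [f [bf f0 Mf]]] := meets P tP (proj1 (int 0 (leq0n n))).
    have fr := @trajectory_eq M f (r a) _ Mlin f0.
    case: (leqP m n) => [lemn|ltnm].
      have eqm : f m = r a m by apply: (fr m) => // i lti; apply: Sa; lia.
      by have [_] := int m lemn; rewrite -eqm.
    have eqn : f n = r a n by apply: (fr n) => // i lti; apply: Mf; lia.
    by apply: (stop (f n.+1)); rewrite -eqn; exact: Mf.
  exists (r a n) => //; apply: (@dipath_mkseq _ E (r a)) => [i /Sa/ME//|i j lei lej eq_r].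
  by have [] := r_inj a a i j Aa Aa _ _ eq_r => // k ltk; apply: Sa; lia.
have rr : injective (r a) by move=> i j /r_inj[].
split=> //; first by split=> // i; apply: ME; exact: Sa.
move=> D tD; have [_ fb _] := tD.
(* Beyond [N0] the ray avoids the finite boundary of [D], so once in [D] it stays interior. Adding
   tight sets around its earlier vertices would make the whole ray interior to one tight set. *)
have [N0 N0P] := ray_avoids rr fb.
apply: contrapT => noN.
have [n0 len Dn] : exists2 n0, N0 <= n0 & D (r a n0).
  apply: contrapT => nex; apply: noN; exists N0 => n0 len Dn.
  by apply: nex; exists n0.
have tail k : interior D (r a (n0 + k)).
  elim: k => [|k /interiorP[_ _ Ek]]; first by rewrite addn0; split=> // /N0P.
  have Dk : D (r a (n0 + k.+1)) by rewrite addnS; apply/Ek/ME/Sa.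
  by split=> //; apply: N0P; lia.
have [x|P [tP DP intP]] := tight_cover (s := mkseq (r a) n0.+1) sub_interior tD.
  by move=> /mapP[i _ ->]; apply: cov; exact: MB (Sa i).
have int i : interior P (r a i).
  case: (leqP i n0) => [lei|lti].
    by apply: intP; apply/mapP; exists i => //; rewrite mem_iota; lia.
  by rewrite -(subnKC (ltnW lti)); exact: sub_interior DP _ (tail _).
have [m [f [bf f0 Mf]]] := meets P tP (proj1 (int 0)).
have eqm : f m = r a m by apply: (@trajectory_eq M f (r a) m Mlin f0 Mf) => // i _; exact: Sa.
by have [_] := int m; rewrite -eqm.
Qed.

End TightSets.

(** * Domination in terms of finite separators *)

Section Reach.
Variables (V : choiceType) (E : rel V).
Implicit Types (B X : set V) (v : V).

Definition reaches B X v := exists p,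
  [/\ path E v p, B (last v p) & forall z, z \in v :: p -> ~ X z].

(** This is [B] together with the vertices dominating it. In this form the closure is easily seen to
    be idempotent, by [reaches_closure]. *)
Definition separation_closure B : set V :=
  [set v | forall X, finite_set X -> ~ X v -> reaches B X v].

Lemma reaches_path B X v p : path E v p -> (forall z, z \in v :: p -> ~ X z) ->
  reaches B X (last v p) -> reaches B X v.
Proof.
move=> Ep nX [q [Eq Bq nXq]]; exists (p ++ q); rewrite cat_path Ep last_cat; split=> // z.
by rewrite -cat_cons mem_cat => /orP[/nX//|zq]; apply: nXq; rewrite inE zq orbT.
Qed.

Lemma reaches_ray B X (r : nat -> V) m k : (forall n, E (r n) (r n.+1)) ->
  (forall i, m <= i <= m + k -> ~ X (r i)) -> reaches B X (r (m + k)) -> reaches B X (r m).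
Proof.
move=> Er; elim: k => [|k IH] nX; first by rewrite addn0.
rewrite addnS => rk; apply: IH => [i lei|]; first by apply: nX; lia.
apply: (@reaches_path _ _ _ [:: r (m + k).+1]) => //=; first by rewrite Er.
by move=> z; rewrite !inE => /orP[]/eqP->; apply: nX; lia.
Qed.

Lemma reaches_closure B X v : finite_set X ->
  reaches (separation_closure B) X v -> reaches B X v.
Proof.
move=> fX [p [Ep Bp nXp]]; apply: (reaches_path Ep nXp).
by apply: Bp => //; apply: nXp; exact: mem_last.
Qed.

Lemma reaches_subset B X Y v : X `<=` Y -> reaches B Y v -> reaches B X v.
Proof. by move=> XY [p [Ep Bp nY]]; exists p; split=> // z /nY nYz /XY. Qed.

Lemma reaches_dipath B X v : reaches B X v -> exists p, dipath_to E v B p /\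
  [set` p] `&` X = set0.
Proof.
move=> [p [+ + nX]]; case/shortenP => q Eq Uq sub Bq.
exists (v :: q); split; first by exists (last v q); rewrite // /dipath !eqxx Eq.
apply/seteqP; split=> // z [/= + Xz]; rewrite inE => /predU1P[eq_z|/sub zp].
  by apply: (nX z) => //; rewrite eq_z mem_head.
by apply: (nX z) => //; rewrite inE zp orbT.
Qed.

Lemma dipath_reaches B X v p : dipath_to E v B p -> [set` p] `&` X = set0 -> reaches B X v.
Proof.
move=> [y By]; case: p => // z q /and4P[/eqP-> /eqP lq Eq _] disj.
exists q; rewrite lq; split=> // w wq Xw.
by have : ([set` v :: q] `&` X) w by []; rewrite disj.
Qed.

(** Each point of [X] lies in at most one member, so only finitely many members have to be
    discarded. *)
Lemma infinite_avoids I T (P : set I) (F : I -> set T) (X : set T) :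
  infinite_set P -> trivIset P F -> finite_set X -> exists2 i, P i & F i `&` X = set0.
Proof.
elim/Pchoice: T => T in F X *; move=> + + /finite_seqP[s ->].
elim: s P => [|x s IH] P infP tr.
  have [i Pi] := infinite_setN0 infP; exists i => //.
  by apply/seteqP; split=> // y [_].
have [P' [infP' P'P nFx]] : exists P', [/\ infinite_set P', P' `<=` P & forall i, P' i -> ~ F i x].
  case: (pselect (exists2 i, P i & F i x)) => [[i Pi Fix]|nex]; last first.
    by exists P; split=> // i Pi Fix; apply: nex; exists i.
  exists (P `\ i); split=> [|j []//|j [Pj neji] Fjx]; first exact: infinite_setD.
  by apply: neji; apply: tr => //; exists x.
have [|i P'i Fs] := IH P' infP'; first by move=> i j /P'P Pi /P'P Pj; exact: tr.
exists i; first exact: P'P.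
apply/seteqP; split=> // y [Fy /=]; rewrite inE => /predU1P[eq_y|ys].
  by apply: (nFx i) => //; rewrite -eq_y.
by have : (F i `&` [set` s]) y by []; rewrite Fs.
Qed.

(* A maximal disjoint family cannot be finite: a further member avoids its union. *)
Lemma infinite_disjoint_family I T (good : set I) (F : I -> set T) :
  (forall i, good i -> finite_set (F i) /\ F i !=set0) ->
  (forall X : set T, finite_set X -> exists2 i, good i & F i `&` X = set0) ->
  exists P, [/\ infinite_set P, P `<=` good & trivIset P F].
Proof.
move=> goodF avoid.
have [G Ggood chain|P [[Pgood tr] Pmax]] :=
  @Zorn_bigcup I (fun P => P `<=` good /\ trivIset P F).
  split=> [i [X GX Xi]|i j [X GX Xi] [Y GY Yj]]; first by have [sub _] := Ggood X GX; exact: sub.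
  have [XY|YX] := chain X Y GX GY.
    by have [_ tr] := Ggood Y GY; apply: tr => //; exact: XY.
  by have [_ tr] := Ggood X GX; apply: tr => //; exact: YX.
exists P; split=> // fP.
have [|i gi Fi] := avoid (\bigcup_(j in P) F j).
  by apply: bigcup_finite => // j /Pgood/goodF[].
have disj j : P j -> F i `&` F j = set0.
  move=> Pj; apply/seteqP; split=> // x [Fix Fjx].
  by have : (F i `&` \bigcup_(j in P) F j) x by [split=> //; exists j]; rewrite Fi.
have nPi : ~ P i.
  move=> Pi; have [_ [x Fx]] := goodF i gi.
  by have : (F i `&` F i) x by []; rewrite disj.
apply: (Pmax (P `|` [set i])); first by split=> [j|/(_ i)]; [left|move=> h; apply/nPi/h; right].
split=> [j [/Pgood//|-> //]|j k [Pj|->] [Pk|->] //]; first exact: tr.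
  by rewrite setIC disj // => -[].
by rewrite disj // => -[].
Qed.

Lemma vertex_dominates_closure B v : vertex_dominates E B v -> separation_closure B v.
Proof.
move=> [P [infP Pd tr]] X fX nXv.
have [p Pp disj] := infinite_avoids infP tr fX.
apply: (dipath_reaches (Pd p Pp)); apply/seteqP; split=> // z [/= zp Xz].
have : (([set` p] `\ v) `&` X) z by split=> //; split=> // eqz; rewrite -eqz in nXv.
by rewrite disj.
Qed.

Lemma sub_separation_closure B : B `<=` separation_closure B.
Proof. by move=> v Bv X _ nXv; exists [::]; split=> // z; rewrite inE => /eqP->. Qed.

Lemma closure_vertex_dominates B v : separation_closure B v -> B v \/ vertex_dominates E B v.
Proof.
move=> clv; case: (pselect (B v)) => [|nBv]; [by left|right].
have [|X fX|P [infP Pgood tr]] :=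
  @infinite_disjoint_family _ _ (dipath_to E v B) (fun p => [set` p] `\ v).
- move=> p [y By]; case: p => // z q /and4P[/eqP-> /eqP lq _ _].
  split; first by apply: finite_setD; exact: finite_seq.
  exists y; split=> /=; first by rewrite -lq mem_last.
  by move=> eqy; rewrite eqy in By.
(* Every path from [v] contains [v], so [v] must be taken out of the separator. *)
- have [|p [pd disj]] := @reaches_dipath B (X `\ v) v.
    by apply: clv; [exact: finite_setD|move=> [_]; apply].
  exists p => //; apply/seteqP; split=> // z [[zp nzv] Xz].
  by have : ([set` p] `&` (X `\ v)) z by []; rewrite disj.
by exists P; split.
Qed.

Lemma ray_dominatesP B (r : nat -> V) : ray_dominates E B r <->
  forall X, finite_set X -> exists n, reaches B X (r n).
Proof.
split=> [[P [infP Pd tr]] X fX|avoid].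
  have [p Pp disj] := infinite_avoids infP tr fX.
  by have [_ [n _ <-] pd] := Pd p Pp; exists n; exact: dipath_reaches pd disj.
have [|X fX|P [infP Pgood tr]] := @infinite_disjoint_family _ _
  (fun p => exists2 x, range r x & dipath_to E x B p) (fun p => [set` p]).
- move=> p [x _ [y _]]; case: p => // z q _; split; first exact: finite_seq.
  by exists z; rewrite /= mem_head.
- have [n /reaches_dipath[p [pd disj]]] := avoid X fX.
  by exists p => //; exists (r n) => //; exists n.
by exists P; split.
Qed.

End Reach.

(** * Dummy sources and maximal linkable sets *)

Section Transfer.
Variables (V : choiceType) (E : rel V) (A B : set V).
Local Notation cl := (separation_closure E B).

(* [(v, 0)] is the vertex [v] and the [(v, n.+1)] are dummy sources, which send
   paths through [v] itself only if [v] lies in the closure of [B]. *)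
Definition dummy_edge : rel (V * nat) := fun x y => (y.2 == 0) &&
  (if (x.2 != 0) && `[< cl x.1 >] then y.1 == x.1 else E x.1 y.1).
Definition lift0 (S : set V) : set (V * nat) := [set w | w.2 = 0 /\ S w.1].
Local Notation EW := dummy_edge.
Local Notation BW := (lift0 cl).

Lemma dummy_edge0 v y : EW (v, 0) y = (y.2 == 0) && E v y.1.
Proof. by []. Qed.

Lemma dummy_edge_dummy v n y : ~ cl v -> EW (v, n) y -> EW (v, 0) y.
Proof. by move=> ncl /andP[y0]; rewrite (asboolF ncl) andbF dummy_edge0 y0. Qed.

Lemma path_lift0 v q : path EW (v, 0) q ->
  exists2 p, q = map (fun u => (u, 0)) p & path E v p.
Proof.
elim: q v => [|[u n] q IH] v; first by exists [::].
rewrite [path _ _ _]/= dummy_edge0 => /andP[/andP[/eqP/= -> Evu] /IH[p -> Ep]].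
by exists (u :: p); rewrite //= Evu.
Qed.

Lemma lift0_path v p : path E v p -> path EW (v, 0) (map (fun u => (u, 0)) p).
Proof. by elim: p v => //= u p IH v /andP[Evu /IH ->]; rewrite dummy_edge0 Evu. Qed.

Definition finitely_linkable (C : set (V * nat)) :=
  forall S, S `<=` C -> finite_set S -> linkable EW S BW.

Hypothesis A_linkable : forall S, S `<=` A -> finite_set S -> linkable E S B.

Lemma lift0_linkable : finitely_linkable (lift0 A).
Proof.
move=> S SA fS.
have [||P [tr PP]] := A_linkable (S := fst @` S); [by move=> _ [w /SA[_ Aw] <-]|exact: finite_image|].
exists (fun w => map (fun u => (u, 0)) (P w.1)); split.
  move=> [v n] [v' n'] Sv Sv' [w [/mapP[u uP ->] /mapP[u' u'P [eq_u]]]].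
  have [[/= -> _] [/= -> _]] := (SA _ Sv, SA _ Sv'); congr pair.
  apply: tr; [by exists (v, n)|by exists (v', n')|].
  by exists u; split; rewrite // eq_u.
move=> [v n] Sv; have [/= n0 Av] := SA _ Sv; rewrite n0 in Sv *.
have [|y By] := PP v; first by exists (v, 0).
rewrite /dipath; case: (P v) => // z q /and4P[/eqP-> /eqP lq Eq U].
exists (y, 0); first by split=> //; exact: sub_separation_closure.
rewrite /= eqxx (last_map _ q) lq eqxx lift0_path //=.
by rewrite mem_map ?map_inj_uniq // => ? ? [].
Qed.

(** Finite linkability has finite character, so Zorn's lemma applies; adjoining [lift0 A] to every
    candidate ensures that [C] contains it. *)
Lemma exists_max_linkable : exists C, [/\ lift0 A `<=` C, finitely_linkable C &
  forall w, ~ C w -> ~ finitely_linkable (C `|` [set w])].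
Proof.
have [F FP chain|C [CP Cmax]] :=
  @Zorn_bigcup (V * nat)%type (fun C => finitely_linkable (C `|` lift0 A)).
  move=> S SF fS; case: (pselect (F !=set0)) => [F0|nF]; last first.
    apply: lift0_linkable => // w /SF[[X FX _]|//]; by case: nF; exists X.
  have [||X FX SX] := @finite_sub_chain _ _ F (fun X => X `|` lift0 A) S F0 _ fS.
  - by move=> X Y FX FY; case: (chain X Y FX FY) => sub; [left|right] => w [/sub|];
      [left|right|left|right].
  - move=> w /SF[[X FX Xw]|Aw]; first by exists X => //; left.
    by have [X FX] := F0; exists X => //; right.
  exact: (FP X FX).
exists (C `|` lift0 A); split=> // w nw lkw.
apply: (Cmax (C `|` [set w])).
  by split=> [v|/(_ w)]; [left|move=> h; apply: nw; left; apply: h; right].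
by rewrite setUAC.
Qed.

Section MaximalSources.
Variable C : set (V * nat).
Hypotheses (C_linkable : finitely_linkable C)
  (C_max : forall w, ~ C w -> ~ finitely_linkable (C `|` [set w])).
Local Notation tight := (tight EW C BW).
Local Notation interior := (interior EW BW).
Local Notation boundary := (boundary EW BW).

Lemma dummy_tight v n : ~ C (v, n.+1) -> exists2 D, tight D & interior D (v, n.+1).
Proof.
move=> nC; apply: (tight_of_not_linkable C_linkable nC) => //; exact: C_max.
Qed.

(** If the dummy [(v, 1)] is in [C], it forms a tight set with its only successor [(v, 0)].
    Otherwise it is interior to a tight set, which then contains that successor. *)
Lemma closure_tight v : cl v -> exists2 D, tight D & D (v, 0).
Proof.
move=> clv; case: (pselect (C (v, 1))) => [Cv|/dummy_tight[D tD /interiorP[_ _ Ev]]]; last first.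
  by exists D => //; apply: Ev; rewrite /dummy_edge /= asboolT.
pose D : set (V * nat) := [set (v, 1); (v, 0)].
have bD : boundary D `<=` [set (v, 0)].
  move=> w [[->|//] [[//]|[[u n] /andP[/= /eqP-> ]]]]; rewrite asboolT // => /eqP-> [].
  by right.
have fb : finite_set (boundary D) by apply: sub_finite_set bD _; exact: finite_set1.
have [fC leC] := card_le_boundary C_linkable fb.
exists D; last by right.
split=> //.
have le1 := card_sub bD (finite_set1 _).
have le2 : card [set (v, 1)] <= card (C `&` D) by apply: card_sub => // w ->; split=> //; left.
rewrite /card !fset_set1 !cardfs1 in le1 le2.
by apply/eqP; rewrite eqn_leq leC; exact: leq_trans le1 le2.
Qed.

(** Let a finite [X] separate [v] from [B], hence from the closure. The vertices so separated, with
    all dummies of [v], have their boundary in the copy of [X], so they cannot include infinitely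
    many elements of [C]. *)
Lemma not_closure_dummy v : ~ cl v -> exists n, ~ C (v, n.+1).
Proof.
move=> /existsNP[X /not_implyP[fX /not_implyP[nXv nreach]]].
apply: contrapT => /forallNP allC.
pose D : set (V * nat) :=
  [set w | if w.2 is 0 then ~ reaches E cl X w.1 else w.1 = v].
have Dv u : E v u -> D (u, 0).
  move=> Evu /= ru; apply/nreach/(reaches_closure fX).
  apply: (@reaches_path _ _ _ _ _ [:: u]) => //=; first by rewrite Evu.
  move=> z; rewrite !inE => /orP[/eqP-> //|/eqP->].
  by have [p [_ _ nXp]] := ru; apply: nXp; exact: mem_head.
have bD : boundary D `<=` (fun u => (u, 0)) @` X.
  have nreachE u y : ~ X u -> ~ reaches E cl X u -> EW (u, 0) y -> D y.
    move=> nXu nr; rewrite dummy_edge0; case: y => w n /andP[/eqP/= -> Euw] /= rw.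
    apply: nr; apply: (@reaches_path _ _ _ _ _ [:: w]) => //=; first by rewrite Euw.
    move=> z; rewrite !inE => /orP[/eqP-> //|/eqP->].
    by have [p [_ _ nXp]] := rw; apply: nXp; exact: mem_head.
  have ncl : ~ cl v by move=> clv; apply: nreach; exact: clv.
  move=> [u [|n]] [/= Du]; last first.
    have -> : u = v := Du; move=> [[]//|[[w m] /(dummy_edge_dummy ncl)]].
    by rewrite dummy_edge0 => /andP[/eqP/= -> /Dv].
  move=> bd; exists u => //; apply: contrapT => nXu.
  case: bd => [[_ /= clu]|[y Euy []]]; last exact: nreachE Euy.
  by apply: Du; exists [::]; split=> // z; rewrite inE => /eqP->.
have fb : finite_set (boundary D) by apply: sub_finite_set bD _; exact: finite_image.
have [fC _] := card_le_boundary C_linkable fb.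
have inj : injective (fun n => (v, n.+1)) by move=> i j [].
have [N NP] := ray_avoids inj fC.
by apply: (NP N) => //; split=> //; apply: contrapT => /allC.
Qed.

(** Over a closure vertex, [w] is a dummy, whose only successor lies in a tight set. Over any other
    [v], all copies have the same successors, and some dummy of [v] is interior to a tight set
    containing these. *)
Lemma tight_interior w : ~ BW w -> exists2 D, tight D & interior D w.
Proof.
case: w => v n nB; case: (pselect (cl v)) => clv.
  have [D tD Dv] := closure_tight clv; apply: (tight_add C_linkable tD nB).
  case: n nB => [[]//|n _] [u m]; rewrite /dummy_edge /= asboolT //.
  by move=> /andP[/eqP-> /eqP->].
have [m /dummy_tight[D tD /interiorP[_ _ ED]]] := not_closure_dummy clv.
apply: (tight_add C_linkable tD nB) => y /(dummy_edge_dummy clv).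
rewrite dummy_edge0 => /andP[y0 Evy]; apply: ED.
by rewrite /dummy_edge /= (asboolF clv) y0.
Qed.

Lemma mem_tight w : exists2 D, tight D & D w.
Proof.
case: (pselect (BW w)) => [|/tight_interior[D tD [Dw _]]]; last by exists D.
by case: w => v n [/= -> /closure_tight].
Qed.

(** The set [D'] of vertices separated from [B] by [X] has its boundary in [X], thus in a tight set
    [D] around [X]; so joining it to [D] adds no boundary, and the ray would stay in the union. *)
Lemma escaping_ray_dominates (r : nat -> V) :
  (forall D, tight D -> exists N, forall n, N <= n -> ~ D (r n, 0)) ->
  ray_dominates E B r.
Proof.
move=> escape; apply/ray_dominatesP => X fX; apply: contrapT => /forallNP nreach.
pose D' : set (V * nat) := lift0 [set u | ~ reaches E B X u].
have [s eqs] : exists s : seq (V * nat), (fun u => (u, 0)) @` X = [set` s].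
  exact/finite_seqP/finite_image.
have [||D [tD _ Ds]] := tight_cover C_linkable (K := id) (s := s) _ (tight0 _ _ _).
- by [].
- by move=> w _; have [D tD Dw] := mem_tight w; exists D.
have bD' w : boundary D' w -> D w.
  case: w => u n [[/= -> nr] bd]; apply: contrapT => nD.
  have nXu : ~ X u.
    move=> Xu; apply/nD/Ds; have : [set` s] (u, 0) by rewrite -eqs; exists u.
    by [].
  case: bd => [[_ /= clu]|[[w m]]]; first by apply: nr; exact: clu.
  rewrite dummy_edge0 => /andP[/eqP/= -> Euw] []; split=> //= rw; apply: nr.
  apply: (@reaches_path _ _ _ _ _ [:: w]) => //=; first by rewrite Euw.
  move=> z; rewrite !inE => /orP[/eqP-> //|/eqP->].
  by have [p [_ _ nXp]] := rw; apply: nXp; exact: mem_head.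
have tU : tight (D `|` D').
  apply: (tight_sup C_linkable tD (@subsetUl _ _ _)) => w bw.
  have [[Dw|D'w] _] := bw; first exact: sub_boundary (@subsetUl _ _ _) Dw bw.
  have Dw : D w by apply: bD'; exact: sub_boundary (@subsetUr _ _ _) D'w bw.
  exact: sub_boundary (@subsetUl _ _ _) Dw bw.
have [N NP] := escape _ tU.
by apply: (NP N) => //; right; split=> //; exact: nreach.
Qed.

End MaximalSources.
End Transfer.

(** * Linkages and finite linkability *)

Section Linkages.
Variables (V : choiceType) (E : rel V) (A B : set V).

(** Every arrow ends at level 0, so the paths and rays starting at the vertices [(a, 0)] stay there
    and project injectively to the original graph. *)
Lemma linkable_domination_linkage :
  (forall S, S `<=` A -> finite_set S -> linkable E S B) ->
  exists Q : V -> path_or_ray V, domination_linkage E A B Q.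
Proof.
move=> A_linkable; have [C [AC lkC maxC]] := exists_max_linkable A_linkable.
have [Q [tr QP]] := linkage_to_closed_target lkC (tight_interior lkC maxC).
pose proj (q : path_or_ray (V * nat)%type) := match q with
  FinPath p => FinPath (map fst p) | Ray r => Ray (fst \o r) end.
have ray0 a r : diray (dummy_edge E B) r -> r 0 = (a, 0) -> forall n, r n = ((r n).1, 0).
  move=> [_ Er] r0 [|n]; first by rewrite r0.
  by have /andP[/eqP + _] := Er n; case: (r n.+1) => u m /= ->.
have path0 a p : dipath_to (dummy_edge E B) (a, 0) (lift0 (separation_closure E B)) p ->
    exists q, [/\ p = map (fun u => (u, 0)) (a :: q), path E a q, uniq (a :: q) &
      separation_closure E B (last a q)].
  move=> [y By]; case: p => // z q /and4P[/eqP-> /eqP lq /path_lift0[q' def_q Eq] U].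
  exists q'; subst q; split=> //.
    by move: U; rewrite -[_ :: _]/(map (fun u => (u, 0)) (a :: q')) => /map_uniq.
  by move: By; rewrite -lq (last_map (fun u => (u, 0))) => -[].
exists (fun a => proj (Q (a, 0))); split.
  have lift a x : A a -> vertices (proj (Q (a, 0))) x -> vertices (Q (a, 0)) (x, 0).
    move=> Aa; have := QP (a, 0) (AC (a, 0) (conj erefl Aa)); case: (Q (a, 0)) => [p|r] /=.
      by move=> /path0[q [-> _ _ _]] /mapP[w /mapP[u uq ->] ->]; apply/mapP; exists u.
    by move=> [dr r0 _] [n _ <-]; exists n => //; exact: ray0 dr r0 n.
  move=> a b Aa Ab [x [/(lift _ _ Aa) xa /(lift _ _ Ab) xb]].
  suff: (a, 0) = (b, 0) by case.
  apply: (tr (a, 0) (b, 0) (AC (a, 0) (conj erefl Aa)) (AC (b, 0) (conj erefl Ab))).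
  by exists (x, 0).
move=> a Aa; have := QP (a, 0) (AC (a, 0) (conj erefl Aa)).
case: (Q (a, 0)) => [p|r] /=.
  move=> /path0[q [-> Eq U clq]]; exists (last a q); last exact: closure_vertex_dominates.
  by rewrite -map_comp map_id_in // /dipath !eqxx Eq.
move=> [dr r0 escape]; have rE := ray0 a r dr r0; split; last 1 first.
- apply: (escaping_ray_dominates lkC maxC) => D /escape[N NP].
  by exists N => n /NP; rewrite rE.
- split=> [i j /= eq_r|n]; first by apply: (proj1 dr); rewrite rE [RHS]rE eq_r.
  by have := proj2 dr n; rewrite rE dummy_edge0 => /andP[].
by rewrite /= r0.
Qed.

Lemma disjoint_avoids (S X : seq V) (F : V -> set V) : uniq S -> size X < size S ->
  trivIset [set` S] F -> exists2 s, s \in S & F s `&` [set` X] = set0.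
Proof.
move=> US ltX tr; apply: contrapT => nex.
have /choice[h hP] : forall s, exists x, s \in S -> F s x /\ x \in X.
  move=> s; case: (pselect (s \in S)) => [Ss|]; last by exists s.
  have /set0P[x [Fx Xx]] : F s `&` [set` X] != set0.
    by apply/eqP => FX; apply: nex; exists s.
  by exists x.
have : size (map h S) <= size X.
  apply: uniq_leq_size => [|_ /mapP[s /hP[_ hX] ->]//].
  rewrite map_inj_in_uniq // => s t sS tS eq_h; apply: tr => //.
  by exists (h s); split; [have [] := hP s sS|rewrite eq_h; have [] := hP t tS].
by rewrite size_map leqNgt ltX.
Qed.

(** A separator [X] smaller than [S] would miss some [Q a]. From there [B] could still be reached
    outside [X], as [Q a] ends in the closure of [B] or is a ray dominating [B]. *)
Lemma domination_linkage_linkable Q : domination_linkage E A B Q ->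
  forall S, S `<=` A -> finite_set S -> linkable E S B.
Proof.
move=> [tr QP] S SA /finite_seqP[s0 def_S].
pose s := undup s0; have {def_S}def_S : S = [set` s].
  by rewrite def_S; apply/seteqP; split=> y /=; rewrite mem_undup.
have [|[X [ltX sep]]] := menger E B (undup_uniq s0); first by rewrite -def_S.
have [|a as_ disj] := disjoint_avoids (F := @vertices V \o Q) (undup_uniq s0) ltX.
  by move=> a b sa sb; apply: tr; apply: SA; rewrite def_S.
have nreach : ~ reaches E B [set` X] a.
  by move=> [p [Ep Bp nXp]]; have /hasP[z zp zX] := sep a p as_ Ep Bp; exact: (nXp z).
have Aa : A a by apply: SA; rewrite def_S.
have fX := finite_seq X.
have := QP a Aa; move: disj => /=; case: (Q a) => [p|r] /= disj.
  move=> [y pd yB]; case: nreach; move: pd disj; rewrite /dipath.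
  case: p => // z q /and4P[/eqP-> /eqP lq Eq _] disj.
  have nX w : w \in a :: q -> ~ [set` X] w.
    by move=> wq Xw; have : ([set` a :: q] `&` [set` X]) w by []; rewrite disj.
  apply: (reaches_path Eq nX); rewrite lq.
  have cly : separation_closure E B y.
    by case: yB => [/sub_separation_closure|/vertex_dominates_closure]; exact.
  by apply: cly => //; apply: nX; rewrite -lq mem_last.
move=> [[_ Er] r0 /ray_dominatesP/(_ _ fX)[n rn]]; case: nreach; rewrite -r0.
apply: (reaches_ray (k := n)) => // i _ Xr.
by have : (range r `&` [set` X]) (r i) by [split=> //; exists i]; rewrite disj.
Qed.

Hypothesis E_sym : symmetric E.

Lemma reaches_path_rev X v p : path E v p -> (forall z, z \in v :: p -> ~ X z) ->
  reaches E B X v -> reaches E B X (last v p).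
Proof.
elim: p v => //= u p IH v /andP[Evu Ep] nX rv.
apply: IH => // [z zp|]; first by apply: nX; rewrite inE zp orbT.
apply: (@reaches_path _ _ _ _ _ [:: v]) => //=; first by rewrite E_sym Evu.
by move=> z; rewrite !inE => /orP[]/eqP->; apply: nX; rewrite !inE eqxx ?orbT.
Qed.

Lemma ray_dominates_equiv (r r' : nat -> V) : diray E r -> ray_equiv E r r' ->
  ray_dominates E B r -> ray_dominates E B r'.
Proof.
move=> [_ Er] rr' rB; apply/ray_dominatesP => X fX.
have [m [n [rX _ [p pd disj]]]] := rr' X fX.
(* Adding the first vertices of [r] to the separator forces [k] beyond [m], so that the segment of
   [r] from [m] to [k] avoids [X]. *)
have [|k rk] := proj1 (ray_dominatesP E B r) rB (X `|` [set r i | i in `I_m.+1]).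
  by rewrite finite_setU; split=> //; apply: finite_image; exact: finite_II.
exists n; have ltmk : m < k.
  rewrite ltnNge; apply/negP => lekm; have [q [_ _ nX]] := rk.
  by apply: (nX (r k)); [exact: mem_head|right; exists k].
have rm : reaches E B X (r m).
  apply: (reaches_ray Er (k := k - m)) => [i|]; first by move=> /andP[/rX].
  by rewrite subnKC 1?ltnW //; apply: reaches_subset rk => x; left.
move: pd disj; case: p => // z q /and4P[/eqP-> /eqP <- Eq _] disj.
apply: reaches_path_rev Eq _ rm => w wq Xw.
by have : ([set` r m :: q] `&` X) w by []; rewrite disj.
Qed.

(** For rays, domination by one ray of an end passes to all others by [ray_dominates_equiv]. *)
Lemma closure_linkageE Q : closure_linkage E A B Q <-> domination_linkage E A B Q.
Proof.
split=> -[tr QP]; split=> // a Aa; have := QP a Aa; case: (Q a) => [p|r] //.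
- by move=> [y By pd]; exists y.
- by move=> [dr r0 [w [_ wB] wr]]; split=> //; exact: wB.
- by move=> [y pd By]; exists y.
move=> [dr r0 rB]; split=> //; exists [set r' | diray E r' /\ ray_equiv E r r'].
  split; first by exists r.
  by move=> r' [_ rr']; exact: ray_dominates_equiv rr' rB.
split=> // S fS; have [N NP] := ray_avoids (proj1 dr) fS.
exists N, N; split=> //; exists [:: r N]; first by rewrite /dipath /= !eqxx.
apply/seteqP; split=> // z [/= ]; rewrite inE => /eqP-> SrN.
by have := NP N (leqnn N).
Qed.

End Linkages.

Theorem theorem1p3 (V : choiceType) (A B : set V)
    (V_infinite : infinite_set [set: V]) :
  (forall E : rel V,
     (exists Q : V -> path_or_ray V, domination_linkage E A B Q) <->
     (forall S : set V, S `<=` A -> finite_set S -> linkable E S B)) /\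
  (forall E : rel V, symmetric E -> irreflexive E ->
     (exists Q : V -> path_or_ray V, closure_linkage E A B Q) <->
     (forall S : set V, S `<=` A -> finite_set S -> linkable E S B)).
Proof.
have main E : (exists Q : V -> path_or_ray V, domination_linkage E A B Q) <->
    (forall S : set V, S `<=` A -> finite_set S -> linkable E S B).
  split=> [[Q QP]|]; last exact: linkable_domination_linkage.
  exact: domination_linkage_linkable QP.
split=> // E E_sym _; apply: iff_trans (main E).
by split=> -[Q /(closure_linkageE _ _ E_sym) QP]; exists Q.
Qed.
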